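(* Suppose a finite-dimensional normed space $X$ admits a public-coin randomized communication protocol for $\mathrm{DTEP}(X,D)$ of size $s$ for approximation $D>1$. Then there exists a map $f:X\to H$ into a Hilbert space $H$ such that for all $x_1,x_2\in X$, $$\min\left\{1,\frac{\|x_1-x_2\|_X}{s\cdot D}\right\}\le\|f(x_1)-f(x_2)\|_H\le K\cdot\|x_1-x_2\|_X^{1/2},$$ where $K>1$ is an absolute constant.
   Context: For a normed space $X$ and $D\ge 1$, $\mathrm{DTEP}(X,D)$ is the problem: Alice holds $x\in X$, Bob holds $y\in X$, and they must decide whether $\|x-y\|\le 1$ (''close'') or $\|x-y\|>D$ (''far''). A public-coin randomized communication protocol of size $s$ for it is a (possibly multi-round) protocol in which Alice and Bob share a public random string, exchange at most $s$ bits in total, and output the correct answer with probability at least $0.9$ for every such input pair. *)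

(* Defs.v *)
From HB Require Import structures.
From mathcomp Require Import all_boot all_order all_algebra.
From mathcomp Require Import all_classical all_reals all_analysis.

Set Implicit Arguments.
Unset Strict Implicit.
Unset Printing Implicit Defensive.

Import Order.TTheory GRing.Theory Num.Theory.
Import numFieldNormedType.Exports.

Local Open Scope classical_set_scope.
Local Open Scope ring_scope.

Definition finite_dimensional (R : realType) (X : normedModType R) : Prop :=
  exists n : nat, inhabited (Vector.axiom n X).

(* With [H] complete, this says that [H] is a real Hilbert space whose norm is
   the one induced by the inner product. *)
Definition hilbert (R : realType) (H : completeNormedModType R) : Prop :=
  exists ip : {dot H for idfun}, forall u : H, `|u| ^+ 2 = ip u u.

(* A deterministic protocol is a tree: at an internal node one party sends one
   bit, which may depend on that party's input and, through the position in the
   tree, on the bits exchanged so far.  At a leaf the answer is announced by a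
   party that knows its own input and the transcript; announcing it is not
   charged.  Answers read off the transcript alone are the case where [out] is
   constant. *)
Inductive protocol (A B : Type) : Type :=
| AliceAnswers (out : A -> bool)
| BobAnswers (out : B -> bool)
| AliceSends (bit : A -> bool) (next : bool -> protocol A B)
| BobSends (bit : B -> bool) (next : bool -> protocol A B).

Fixpoint answer (A B : Type) (p : protocol A B) (x : A) (y : B) : bool :=
  match p with
  | AliceAnswers out => out x
  | BobAnswers out => out y
  | AliceSends bit next => answer (next (bit x)) x y
  | BobSends bit next => answer (next (bit y)) x y
  end.

(* The worst-case number of bits exchanged, i.e. the depth of the tree. *)
Fixpoint cost (A B : Type) (p : protocol A B) : nat :=
  match p with
  | AliceAnswers _ | BobAnswers _ => 0
  | AliceSends _ next | BobSends _ next =>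
      (maxn (cost (next true)) (cost (next false))).+1
  end.

(* The public random string is a point of an arbitrary probability space; it
   selects a deterministic protocol.  The answer [true] stands for "close" and
   [false] for "far"; nothing is required on pairs that are neither, except that
   the answer be a random variable. *)
Definition has_DTEP_protocol (R : realType) (X : normedModType R) (D : R)
    (s : nat) : Prop :=
  exists (d : measure_display) (Omega : measurableType d)
         (P : probability Omega R) (p : Omega -> protocol X X),
  [/\ forall w, (cost (p w) <= s)%N,
      forall x y : X, measurable_fun setT (fun w => answer (p w) x y),
      forall x y : X, `|x - y| <= 1 ->
        ((9 / 10)%:E <= P [set w | answer (p w) x y = true])%E
    & forall x y : X, D < `|x - y| ->
        ((9 / 10)%:E <= P [set w | answer (p w) x y = false])%E].

(* Main.v *)
(** Fix a finite set of points.  Given weights [mu] on pairs, feed the protocol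
    with [x + sum_j x_j] and [y + sum_j y_j], where the [m - 1] pairs [(x_j, y_j)]
    are independent with law [mu] and [m] is about [s / E|x_j - y_j|].  The sums
    move the two inputs by [O(s)] only, so the answer still tells [x = y] from
    [|x - y| >= C s D].  On the other hand [m] independent hidden bits (which of
    [x_j], [y_j] a party uses) are encoded in a transcript of [s] bits, and the
    level-1 inequality on the cube bounds the average squared Hellinger distance
    between the transcripts of [(x, x)] and [(y, y)] by [O(s / m)], that is by
    [O(E|x_j - y_j|)].  Square roots of transcript probabilities are thus unit
    vectors separating far points, whose squared distances are [mu]-on-average
    at most [C |x - y|].

    A min-max argument over [mu] replaces "on average" by "for all pairs", the
    direct sum over [j] of copies precomposed with [x -> 2^j x], damped by [2^-j],
    gives the lower bound [|x - y| / (s D)] at small scales, and compactness passes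
    from finite sets to a kernel on the whole of [X].  A Cholesky factorization along
    a dense sequence realizes this kernel in l^2. *)

Require Import Defs.
From HB Require Import structures.
From mathcomp Require Import all_boot all_order all_algebra.
From mathcomp Require Import all_classical all_reals all_analysis.
From mathcomp Require Import ring lra zify.

Set Implicit Arguments.
Unset Strict Implicit.
Unset Printing Implicit Defensive.

Import Order.TTheory GRing.Theory Num.Theory.
Import numFieldNormedType.Exports.

Local Open Scope classical_set_scope.
Local Open Scope ring_scope.

(** * The Hilbert space of square-summable sequences *)

Section SquareSummable.
Variable R : realType.
Implicit Types u v w : nat -> R.

Definition square_summable : {pred nat -> R} :=
  fun u => `[< exists M, forall n, \sum_(k < n) u k ^+ 2 <= M >].

Lemma square_summable_submod : submod_closed square_summable.
Proof.
split=> [|a u v /asboolP[M uM] /asboolP[N vN]]; apply/asboolP.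
  by exists 0 => n; rewrite big1// => i _; rewrite expr0n.
exists (2 * a ^+ 2 * M + 2 * N) => n.
apply: (@le_trans _ _ (\sum_(k < n) (2 * a ^+ 2 * u k ^+ 2 + 2 * v k ^+ 2))).
  apply: ler_sum => k _ /=.
  rewrite (_ : (a *: u + v) k = (a * u k + v k)%R :> R)//.
  rewrite -subr_ge0 [X in 0 <= X](_ : _ = (a * u k - v k) ^+ 2) ?sqr_ge0//.
  by ring.
rewrite big_split -!mulr_sumr lerD// ler_wpM2l ?uM ?vN//.
by rewrite mulr_ge0// sqr_ge0.
Qed.

HB.instance Definition _ :=
  GRing.isSubmodClosed.Build R (nat -> R) square_summable square_summable_submod.

Record ell2 := Ell2 { ell2_val :> nat -> R; ell2P : ell2_val \in square_summable }.

HB.instance Definition _ := [isSub for ell2_val].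
HB.instance Definition _ := [Choice of ell2 by <:].
HB.instance Definition _ := [SubChoice_isSubLmodule of ell2 by <:].

Implicit Types x y z : ell2.

Lemma ell2D x y k : (x + y) k = x k + y k. Proof. by []. Qed.
Lemma ell2B x y k : (x - y) k = x k - y k. Proof. by []. Qed.
Lemma ell2Z a x k : (a *: x) k = a * x k. Proof. by []. Qed.

Lemma ell2_eqP x y : (forall k, x k = y k) -> x = y.
Proof. by move=> xy; apply: val_inj; exact/funext. Qed.

Lemma is_cvg_sum_sqr x : cvgn (fun n => \sum_(k < n) x k ^+ 2).
Proof.
have /asboolP[M xM] := ell2P x.
apply: nondecreasing_is_cvgn; last by exists M => _ [n _ <-].
apply/nondecreasing_seqP => n.
by rewrite big_ord_recr /= lerDl sqr_ge0.
Qed.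

Definition ell2_dot x y : R := limn (fun n => \sum_(k < n) x k * y k).

Lemma ell2_dot_cvg x y :
  (fun n => \sum_(k < n) x k * y k) @ \oo --> ell2_dot x y.
Proof.
(* Polarization reduces convergence of the product series to that of three series of squares. *)
rewrite /ell2_dot (_ : (fun _ => _) = (fun n => 2^-1 *
   (\sum_(k < n) (x + y) k ^+ 2 - \sum_(k < n) x k ^+ 2
    - \sum_(k < n) y k ^+ 2))).
  apply: is_cvgM; first exact: is_cvg_cst.
  apply: is_cvgB; last exact: is_cvg_sum_sqr.
  by apply: is_cvgB; exact: is_cvg_sum_sqr.
apply/funext => n; rewrite -!sumrB mulr_sumr; apply: eq_bigr => k _.
by rewrite ell2D; field.
Qed.

Lemma ell2_dotC x y : ell2_dot x y = ell2_dot y x.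
Proof.
rewrite /ell2_dot; congr (limn _); apply/funext => n.
by apply: eq_bigr => k _; rewrite mulrC.
Qed.

Lemma ell2_dotPl a x y z :
  ell2_dot (a *: x + y) z = a * ell2_dot x z + ell2_dot y z.
Proof.
rewrite {1}/ell2_dot; apply: cvg_lim => //.
rewrite (_ : (fun _ => _) = (fun n => a * (\sum_(k < n) x k * z k)
                                      + \sum_(k < n) y k * z k)).
  by apply: cvgD; [apply: cvgM; [exact: cvg_cst|]|]; exact: ell2_dot_cvg.
apply/funext => n; rewrite mulr_sumr -big_split; apply: eq_bigr => k _.
by rewrite ell2D ell2Z mulrDl mulrA.
Qed.

Lemma ell2_dotE x : ell2_dot x x = limn (fun n => \sum_(k < n) x k ^+ 2).
Proof. by []. Qed.

Lemma ell2_dot_ge_sum x n : \sum_(k < n) x k ^+ 2 <= ell2_dot x x.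
Proof.
rewrite ell2_dotE.
apply: (nondecreasing_cvgn_le (u_ := fun n => \sum_(k < n) x k ^+ 2)) => //.
  by apply/nondecreasing_seqP => m; rewrite big_ord_recr /= lerDl sqr_ge0.
exact: is_cvg_sum_sqr.
Qed.

Lemma ell2_dot_le x M :
  (forall n, \sum_(k < n) x k ^+ 2 <= M) -> ell2_dot x x <= M.
Proof.
by rewrite ell2_dotE => xM; apply: limr_le; [exact: is_cvg_sum_sqr|exact: nearW].
Qed.

Lemma ell2_dot_ge0 x : 0 <= ell2_dot x x.
Proof. by have := ell2_dot_ge_sum x 0; rewrite big_ord0. Qed.

Lemma ell2_dot_eq0 x : ell2_dot x x = 0 -> x = 0.
Proof.
move=> x0; apply: ell2_eqP => k; apply/eqP; rewrite -sqrf_eq0.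
have := ell2_dot_ge_sum x k.+1; rewrite x0 big_ord_recr /= => xk.
rewrite eq_le sqr_ge0 andbT; apply: le_trans xk; rewrite lerDr.
by apply: sumr_ge0 => i _; exact: sqr_ge0.
Qed.

Lemma ell2_dotDl x y z : ell2_dot (x + y) z = ell2_dot x z + ell2_dot y z.
Proof. by rewrite -[x]scale1r ell2_dotPl scale1r mul1r. Qed.

Lemma ell2_dot0l z : ell2_dot 0 z = 0.
Proof. by have := ell2_dotDl 0 0 z; rewrite addr0; lra. Qed.

Lemma ell2_dotZl a x z : ell2_dot (a *: x) z = a * ell2_dot x z.
Proof. by rewrite -[a *: x]addr0 ell2_dotPl ell2_dot0l addr0. Qed.

Lemma ell2_dotDr x y z : ell2_dot z (x + y) = ell2_dot z x + ell2_dot z y.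
Proof. by rewrite ell2_dotC ell2_dotDl !(ell2_dotC z). Qed.

Lemma ell2_dotZr a x z : ell2_dot z (a *: x) = a * ell2_dot z x.
Proof. by rewrite ell2_dotC ell2_dotZl (ell2_dotC z). Qed.

Definition ell2_norm x := Num.sqrt (ell2_dot x x).

Lemma ell2_norm_sqr x : ell2_norm x ^+ 2 = ell2_dot x x.
Proof. by rewrite sqr_sqrtr// ell2_dot_ge0. Qed.

Lemma ell2_norm_eq0 x : ell2_norm x = 0 -> x = 0.
Proof. by move=> x0; apply: ell2_dot_eq0; rewrite -ell2_norm_sqr x0 expr0n. Qed.

Lemma ell2_normZ a x : ell2_norm (a *: x) = `|a| * ell2_norm x.
Proof.
by rewrite /ell2_norm ell2_dotZl ell2_dotZr mulrA -expr2 sqrtrM ?sqr_ge0// sqrtr_sqr.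
Qed.

Lemma ell2_dot_le_norm x y : ell2_dot x y <= ell2_norm x * ell2_norm y.
Proof.
have [/ell2_norm_eq0->|x0] := eqVneq (ell2_norm x) 0.
  by rewrite ell2_dot0l mulr_ge0// sqrtr_ge0.
have [/ell2_norm_eq0->|y0] := eqVneq (ell2_norm y) 0.
  by rewrite ell2_dotC ell2_dot0l mulr_ge0// sqrtr_ge0.
(* Expanding this square gives Cauchy-Schwarz multiplied by the product of the two norms. *)
have := ell2_dot_ge0 (ell2_norm y *: x + (- ell2_norm x) *: y).
rewrite !(ell2_dotDl, ell2_dotDr, ell2_dotZl, ell2_dotZr) (ell2_dotC y x).
rewrite -!ell2_norm_sqr => h.
have pq : 0 < ell2_norm x * ell2_norm y.
  by rewrite mulr_gt0// lt_neqAle eq_sym ?x0 ?y0 sqrtr_ge0.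
rewrite -(ler_pM2l pq); nra.
Qed.

Lemma ell2_normD x y : ell2_norm (x + y) <= ell2_norm x + ell2_norm y.
Proof.
rewrite -(ler_pXn2r (n := 2))// ?nnegrE ?addr_ge0 ?sqrtr_ge0//.
rewrite ell2_norm_sqr sqrrD !(ell2_dotDl, ell2_dotDr) (ell2_dotC y x).
rewrite -!ell2_norm_sqr; have := ell2_dot_le_norm x y; lra.
Qed.

HB.instance Definition _ := Lmodule_isNormed.Build R ell2
  ell2_normD ell2_normZ ell2_norm_eq0.

Lemma ell2_normE x : `|x| = ell2_norm x. Proof. by []. Qed.

Lemma ell2_sum_le_norm x n : \sum_(k < n) x k ^+ 2 <= `|x| ^+ 2.
Proof. by rewrite ell2_normE ell2_norm_sqr ell2_dot_ge_sum. Qed.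

Lemma ell2_coord_le x k : `|x k| <= `|x|.
Proof.
rewrite -(ler_pXn2r (n := 2))// ?nnegrE// real_normK ?num_real//.
apply: le_trans (ell2_sum_le_norm x k.+1); rewrite big_ord_recr /= lerDr.
by apply: sumr_ge0 => i _; exact: sqr_ge0.
Qed.

(** A Cauchy filter converges in each coordinate. A bound on a finite partial sum of squares
    survives the coordinatewise limit [l], which yields both that [l] is square summable and that
    the convergence holds in norm. *)
Lemma ell2_complete (F : set_system ell2) : ProperFilter F -> cauchy F -> cvg F.
Proof.
move=> FF /cauchyP Fc.
have cvgk k : cvg ((fun x : ell2 => x k : R^o) @ F).
  apply: (@cauchy_cvg R^o); apply: cauchy_exP => e e0.
  have [x Fx] := Fc e e0; exists (x k).
  rewrite /fmap /= /nbhs /=; apply: filterS Fx => /= y xy; rewrite -ball_normE /=.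
  have {xy} : `|x - y| < e by move: xy; rewrite -ball_normE.
  by move=> /(le_lt_trans _) h; apply: h; rewrite -ell2B; exact: ell2_coord_le.
pose l k : R := lim ((fun x : ell2 => x k : R^o) @ F).
have lk k : (fun x : ell2 => x k) @ F --> l k by exact: cvgk.
have close e x : 0 < e -> F (ball x e) ->
    forall n, \sum_(k < n) (l k - x k) ^+ 2 <= e ^+ 2.
  move=> e0 Fx n.
  have h : (fun y : ell2 => \sum_(k < n) (y k - x k) ^+ 2) @ F -->
     \sum_(k < n) (l k - x k) ^+ 2.
    apply: cvg_big => [|k _]; first exact: add_continuous.
    by apply: cvgM; apply: cvgB => //; exact: cvg_cst.
  apply: (closed_cvg _ (@closed_le _ (e ^+ 2)) _ _ h).
  apply: filterS Fx => y; rewrite -ball_normE /= distrC => xy.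
  apply: le_trans (ell2_sum_le_norm (y - x) n) _.
  by rewrite ler_pXn2r ?nnegrE// ltW.
have lP : l \in square_summable.
  have [x Fx] := Fc 1 ltr01.
  suff lx : (l - (x : nat -> R))%R \in square_summable.
    by rewrite -[l](subrK (x : nat -> R)) rpredD ?ell2P.
  by apply/asboolP; exists (1 ^+ 2) => n; exact: close.
apply/cvg_ex; exists (Ell2 lP); apply/cvgrPdist_le => e e0.
have [x Fx] := Fc (e / 2) (divr_gt0 e0 (ltr0Sn _ _)).
have lx : `|Ell2 lP - x| <= e / 2.
  rewrite -(ler_pXn2r (n := 2))// ?nnegrE ?divr_ge0 ?(ltW e0)//.
  rewrite ell2_normE ell2_norm_sqr; apply: ell2_dot_le => n.
  by apply: (close (e / 2) x) => //; rewrite divr_gt0.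
apply: filterS Fx => y; rewrite -ball_normE /= => xy.
rewrite [e]splitr -[_ - y](subrKA x) (le_trans (ler_normD _ _))// lerD// ltW//.
Qed.

HB.instance Definition _ := Uniform_isComplete.Build ell2 ell2_complete.

Lemma ell2_dot_bilinear : bilinear_for
  (GRing.Scale.Law.clone _ _ *%R _) (GRing.Scale.Law.clone _ _ (idfun \; *%R) _)
  (ell2_dot : ell2 -> ell2 -> R).
Proof.
split=> [z|z] a x y /=; first by rewrite ell2_dotPl.
by rewrite ell2_dotDr ell2_dotZr.
Qed.

HB.instance Definition _ := bilinear_isBilinear.Build R ell2 ell2 R
  *%R (idfun \; *%R) ell2_dot ell2_dot_bilinear.

Lemma ell2_dot_hermitian (x y : ell2) :
  ell2_dot x y = (-1) ^+ false * idfun (ell2_dot y x).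
Proof. by rewrite expr0 mul1r /= ell2_dotC. Qed.

HB.instance Definition _ :=
  isHermitianSesquilinear.Build R ell2 false idfun ell2_dot ell2_dot_hermitian.

Lemma ell2_dot_gt0 (x : ell2) : x != 0 -> 0 < ell2_dot x x.
Proof.
move=> x0; rewrite lt_neqAle ell2_dot_ge0 andbT eq_sym.
by apply: contra_neq x0; exact: ell2_dot_eq0.
Qed.

HB.instance Definition _ := isDotProduct.Build R ell2 ell2_dot ell2_dot_gt0.

Lemma hilbert_ell2 : hilbert ell2.
Proof.
exists (ell2_dot : {dot ell2 for idfun}) => x.
by rewrite ell2_normE ell2_norm_sqr.
Qed.

End SquareSummable.

(** * Positive semidefinite kernels *)

Section Kernels.
Variables (R : realType) (X : Type).
Implicit Types (k : X -> X -> R) (x y a : X).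

Definition psd k := (forall x y, k x y = k y x) /\
  forall s : seq (R * X), 0 <= \sum_(u <- s) \sum_(v <- s) u.1 * v.1 * k u.2 v.2.

(** The squared distance between the feature vectors of [x] and [y]. *)
Definition kdist k x y := k x x + k y y - 2 * k x y.

Lemma psd_quad k x y (b c : R) : psd k ->
  0 <= b ^+ 2 * k x x + 2 * b * c * k x y + c ^+ 2 * k y y.
Proof.
move=> [sk pk]; have := pk [:: (b, x); (c, y)].
rewrite !big_cons !big_nil /= (sk y x).
by move=> h; apply: etrans h; congr (_ <= _); ring.
Qed.

Arguments psd_quad [k] x y b c _.

Lemma psd_diag_ge0 k x : psd k -> 0 <= k x x.
Proof. move=> pk; have := psd_quad x x 1 0 pk; lra. Qed.

Lemma kdist_ge0 k x y : psd k -> 0 <= kdist k x y.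
Proof. move=> pk; have := psd_quad x y 1 (-1) pk; rewrite /kdist; lra. Qed.

Lemma kdist_le k x y : psd k -> kdist k x y <= 2 * (k x x + k y y).
Proof. move=> pk; have := psd_quad x y 1 1 pk; rewrite /kdist; lra. Qed.

Lemma psd_abs_le k x y (M : R) : psd k -> (forall z, k z z <= M) -> `|k x y| <= M.
Proof.
move=> pk kM; rewrite ler_norml.
have := psd_quad x y 1 1 pk; have := psd_quad x y 1 (-1) pk.
have := kM x; have := kM y; lra.
Qed.

Lemma psd_diag_eq0 k a y : psd k -> k a a = 0 -> k a y = 0.
Proof.
move=> pk ka0; apply/eqP; apply: contraT => kay.
(* With [k a a = 0] the form is affine in the first weight, chosen here so that its value is -1. *)
have := psd_quad a y (- (k y y + 1) / (2 * k a y)) 1 pk.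
rewrite ka0 (_ : _ + _ + _ = - 1); first by lra.
by field.
Qed.

(** The coordinate of [x] along the normalized feature vector of [a]. If [k a a = 0], the division
    returns 0 and [schur] leaves the kernel unchanged. *)
Definition pivot k a x := k x a / Num.sqrt (k a a).

Definition schur k a x y := k x y - pivot k a x * pivot k a y.

Lemma sum_sqr_seq (I : Type) (s : seq I) (F : I -> R) :
  (\sum_(u <- s) F u) ^+ 2 = \sum_(u <- s) \sum_(v <- s) F u * F v.
Proof. by rewrite expr2 mulr_suml; apply: eq_bigr => u _; rewrite mulr_sumr. Qed.

Lemma psd_schur k a : psd k -> psd (schur k a).
Proof.
move=> pk; have [sk qk] := pk.
split=> [x y|s]; first by rewrite /schur sk [pivot _ _ x * _]mulrC.
have -> : \sum_(u <- s) \sum_(v <- s) u.1 * v.1 * schur k a u.2 v.2 =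
    \sum_(u <- s) \sum_(v <- s) u.1 * v.1 * k u.2 v.2
    - (\sum_(u <- s) u.1 * pivot k a u.2) ^+ 2.
  rewrite sum_sqr_seq -sumrB; apply: eq_bigr => u _.
  rewrite -sumrB; apply: eq_bigr => v _; rewrite /schur; ring.
have [ka0|ka0] := eqVneq (k a a) 0.
  rewrite [X in _ - X ^+ 2]big1 ?expr0n ?subr0// => u _.
  by rewrite /pivot ka0 sqrtr0 invr0 !mulr0.
have kagt0 : 0 < k a a by rewrite lt_neqAle eq_sym ka0 psd_diag_ge0.
set S := \sum_(u <- s) u.1 * k u.2 a.
have -> : \sum_(u <- s) u.1 * pivot k a u.2 = S / Num.sqrt (k a a).
  by rewrite mulr_suml; apply: eq_bigr => u _; rewrite mulrA.
rewrite exprMn exprVn sqr_sqrtr ?(ltW kagt0)//.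
(* The weight added at [a] minimizes the quadratic form, and the minimum is the form of the Schur
   complement. *)
have := qk ((- S / k a a, a) :: s).
rewrite !big_cons /=.
have -> : \sum_(j <- s) - S / k a a * j.1 * k a j.2 = - S ^+ 2 / k a a.
  rewrite [in RHS]expr2 -mulNr -mulrA [S * _]mulrC mulrA {3}/S mulr_sumr.
  by apply: eq_bigr => u _; rewrite sk -mulrA.
under eq_bigr do rewrite big_cons /=.
rewrite big_split /=.
have -> : \sum_(j <- s) j.1 * (- S / k a a) * k j.2 a = - S ^+ 2 / k a a.
  rewrite [in RHS]expr2 -mulNr -mulrA [S * _]mulrC mulrA {3}/S mulr_sumr.
  by apply: eq_bigr => u _; rewrite mulrAC [RHS]mulrC.
by move=> h; apply: etrans h; congr (_ <= _); field.
Qed.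

Lemma schur0 k a y : psd k -> schur k a a y = 0.
Proof.
move=> pk; rewrite /schur /pivot.
have [ka0|ka0] := eqVneq (k a a) 0.
  by rewrite ka0 sqrtr0 invr0 !mulr0 (psd_diag_eq0 _ pk ka0) subrr.
rewrite mulrACA -invfM -expr2 sqr_sqrtr ?psd_diag_ge0// mulrAC divff// mul1r.
by rewrite (pk.1 y a) subrr.
Qed.

Lemma kdist_schur k a x y :
  kdist (schur k a) x y = kdist k x y - (pivot k a x - pivot k a y) ^+ 2.
Proof. by rewrite /kdist /schur; ring. Qed.

(** * Cholesky features along a sequence of pivots *)

Section Cholesky.
Variables (k : X -> X -> R) (a : nat -> X).
Hypothesis pk : psd k.

Fixpoint residual n := if n is n'.+1 then schur (residual n') (a n') else k.

Definition cholesky x n := pivot (residual n) (a n) x.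

Lemma psd_residual n : psd (residual n).
Proof. by elim: n => //= n; exact: psd_schur. Qed.

Lemma residual0 n j y : (j < n)%N -> residual n (a j) y = 0.
Proof.
elim: n y => // n IH y; rewrite ltnS leq_eqVlt => /predU1P[->|jn] /=.
  exact/schur0/psd_residual.
by rewrite /schur /pivot !IH// !mul0r subrr.
Qed.

Lemma residual_diag x n :
  residual n x x = k x x - \sum_(i < n) cholesky x i ^+ 2.
Proof.
elim: n => [|n IH] /=; first by rewrite big_ord0 subr0.
by rewrite /schur IH big_ord_recr /= expr2 opprD addrA.
Qed.

Lemma kdist_residual x y n : kdist (residual n) x y =
  kdist k x y - \sum_(i < n) (cholesky x i - cholesky y i) ^+ 2.
Proof.
elim: n => [|n IH] /=; first by rewrite big_ord0 subr0.
by rewrite kdist_schur IH big_ord_recr /= opprD addrA.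
Qed.

Lemma cholesky_summable x : cholesky x \in @square_summable R.
Proof.
apply/asboolP; exists (k x x) => n; rewrite -subr_ge0 -residual_diag.
exact/psd_diag_ge0/psd_residual.
Qed.

Definition feature x : ell2 R := Ell2 (cholesky_summable x).

(** The first [n] coordinates account for [kdist k x y] up to the distance in the [n]-th residual
    kernel. That remainder is nonnegative, and it tends to 0 when the pivots are dense for
    [kdist k]. *)
Lemma feature_dist x y :
  (forall z (e : R), 0 < e -> exists j, kdist k z (a j) < e) ->
  `|feature x - feature y| ^+ 2 = kdist k x y.
Proof.
move=> da; rewrite ell2_normE ell2_norm_sqr; apply/eqP; rewrite eq_le.
apply/andP; split.
  apply: ell2_dot_le => n; rewrite -subr_ge0 -kdist_residual.
  exact/kdist_ge0/psd_residual.
apply/ler_addgt0Pr => e e0.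
(* The residual kernel vanishes at a used pivot [a j], so [residual n z z] is the residual distance
   from [z] to [a j], at most the original one. *)
have small z : exists N, forall n, (N <= n)%N -> residual n z z < e / 4.
  have [j zj] := da z (e / 4) ltac:(lra).
  exists j.+1 => n jn.
  have : kdist (residual n) z (a j) <= kdist k z (a j).
    by rewrite kdist_residual gerBl sumr_ge0// => i _; exact: sqr_ge0.
  rewrite /kdist (psd_residual n).1 !residual0//; rewrite /kdist in zj; lra.
have [N1 h1] := small x; have [N2 h2] := small y.
set n := maxn N1 N2.
have r1 := h1 n (leq_maxl _ _); have r2 := h2 n (leq_maxr _ _).
have := ell2_dot_ge_sum (feature x - feature y) n.
have := kdist_residual x y n; have := kdist_le x y (psd_residual n).
rewrite (_ : \sum_(i < n) (cholesky x i - cholesky y i) ^+ 2 =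
  \sum_(i < n) (feature x - feature y) i ^+ 2)//; lra.
Qed.
End Cholesky.
End Kernels.

(** * The level-1 inequality on the cube *)

Section ExpBounds.
Variable R : realType.

Lemma expR_jensen (I : finType) (w Q : I -> R) :
  (forall i, 0 <= w i) -> \sum_i w i = 1 ->
  expR (\sum_i w i * Q i) <= \sum_i w i * expR (Q i).
Proof.
move=> w0 w1; set a := \sum_i w i * Q i.
(* The tangent line to [expR] at the mean [a] averages to [expR a] and lies below the curve. *)
have <- : \sum_i w i * (expR a * (1 + (Q i - a))) = expR a.
  under eq_bigr => i _ do rewrite mulrCA mulrDr mulr1 mulrBr addrA.
  by rewrite -mulr_sumr sumrB big_split /= -mulr_suml w1 -/a mul1r addrK mulr1.
apply: ler_sum => i _; rewrite ler_wpM2l//.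
rewrite -[Q i in leRHS](subrK a) expRD mulrC ler_wpM2r ?expR_ge0//.
exact: expR_ge1Dx.
Qed.

(** Since [expR (- x) >= 1 - x], it suffices that [(1 + x + 2 x^2) (1 - x) = 1 + x^2 (1 - 2 x)] is
    at least 1. *)
Lemma expR_le_quad (x : R) : x <= 1 / 2 -> expR x <= 1 + x + 2 * x ^+ 2.
Proof.
move=> xle; have h : 1 + - x <= expR (- x) := expR_ge1Dx _.
rewrite -[x in leLHS]opprK expRN; set y := expR (- x) in h *.
have y0 : 0 < y := expR_gt0 _.
rewrite -[leLHS]mul1r ler_pdivrMr//.
have q0 : 0 <= 1 + x + 2 * x ^+ 2 by nra.
apply: le_trans (ler_wpM2l q0 h); nra.
Qed.

Lemma cosh_le (x : R) : `|x| <= 1 / 2 ->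
  (expR x + expR (- x)) / 2 <= expR (2 * x ^+ 2).
Proof.
rewrite ler_norml => /andP[x1 x2].
apply: le_trans (expR_ge1Dx _).
have := expR_le_quad x2; have := @expR_le_quad (- x) ltac:(lra).
rewrite sqrrN; lra.
Qed.

Lemma sqrt_diff_le (p w : R) : `|w| <= p ->
  (Num.sqrt (p + w) - Num.sqrt (p - w)) ^+ 2 <= 2 * (p * (w / p) ^+ 2).
Proof.
move=> wp; have [p0|p0] := eqVneq p 0.
  move: wp; rewrite p0 normr_le0 => /eqP ->.
  by rewrite addr0 subr0 subrr expr0n !mul0r mulr0.
have pgt0 : 0 < p by rewrite lt_neqAle eq_sym p0 (le_trans _ wp).
move: wp; rewrite ler_norml => /andP[w1 w2].
have -> : p * (w / p) ^+ 2 = w ^+ 2 / p by field.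
rewrite mulrA ler_pdivlMr//.
set u := Num.sqrt _; set v := Num.sqrt _.
have u0 : 0 <= u := sqrtr_ge0 _; have v0 : 0 <= v := sqrtr_ge0 _.
have u2 : u ^+ 2 = p + w by rewrite sqr_sqrtr//; lra.
have v2 : v ^+ 2 = p - w by rewrite sqr_sqrtr//; lra.
have -> : p = (u ^+ 2 + v ^+ 2) / 2 by lra.
have -> : w = (u ^+ 2 - v ^+ 2) / 2 by lra.
(* In terms of [u] and [v], this product is exactly the difference of the two sides. *)
have : 0 <= (u - v) ^+ 2 * (u * v) by rewrite mulr_ge0 ?sqr_ge0 ?mulr_ge0.
by move=> h; rewrite -subr_ge0; apply: etrans h; congr (_ <= _); field.
Qed.

End ExpBounds.

Section Cube.
Variables (R : realType) (m : nat).
Local Notation cube := {ffun 'I_m -> bool}.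
Implicit Types (g : cube -> R) (b : cube) (i : 'I_m).

Definition cube_avg g : R := (\sum_b g b) / 2 ^+ m.

Definition bit_sign (c : bool) : R := if c then 1 else - 1.

Definition set_bit b i c : cube := [ffun j => if j == i then c else b j].

Lemma cube_avg_ge0 g : (forall b, 0 <= g b) -> 0 <= cube_avg g.
Proof. by move=> g0; rewrite divr_ge0 ?exprn_ge0// sumr_ge0. Qed.

Lemma cube_avg1 : cube_avg (fun=> 1) = 1.
Proof.
by rewrite /cube_avg sumr_const card_ffun card_bool card_ord natrX divff.
Qed.

Lemma cube_avg_sum (I : finType) (g : I -> cube -> R) :
  \sum_i cube_avg (g i) = cube_avg (fun b => \sum_i g i b).
Proof. by rewrite -mulr_suml exchange_big. Qed.

Lemma ler_cube_avg g h : (forall b, g b <= h b) -> cube_avg g <= cube_avg h.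
Proof. by move=> gh; rewrite ler_wpM2r ?invr_ge0 ?exprn_ge0// ler_sum. Qed.

Lemma cube_avg_norm g : `|cube_avg g| <= cube_avg (fun b => `|g b|).
Proof.
rewrite /cube_avg normrM [X in _ * X]ger0_norm ?invr_ge0 ?exprn_ge0//.
rewrite ler_wpM2r ?invr_ge0 ?exprn_ge0//; exact: ler_norm_sum.
Qed.

(** The level-1 Fourier coefficient of [g] at [i], up to the sign convention of [bit_sign]. *)
Definition bit_corr g i := cube_avg (fun b => g b * bit_sign (b i)).

Lemma bit_corr_le g i : (forall b, 0 <= g b) -> `|bit_corr g i| <= cube_avg g.
Proof.
move=> g0; apply: le_trans (cube_avg_norm _) _; apply: ler_cube_avg => b.
by rewrite normrM ger0_norm// /bit_sign; case: ifP; rewrite ?normrN normr1 mulr1.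
Qed.

Lemma cube_avg_set_bit g i c :
  cube_avg (fun b => g (set_bit b i c)) = cube_avg g + bit_sign c * bit_corr g i.
Proof.
pose flip b : cube := set_bit b i (~~ b i).
have flipK : involutive flip.
  move=> b; apply/ffunP => j; rewrite !ffunE eqxx.
  by case: eqP => [->|//]; rewrite negbK.
rewrite /bit_corr /cube_avg mulrA -mulrDl; congr (_ / _).
rewrite mulr_sumr -big_split /=.
rewrite [RHS](_ : _ = \sum_(b : cube) (if b i == c then 2 * g b else 0)); last first.
  apply: eq_bigr => b _; rewrite /bit_sign.
  by case: (b i); case: c => /=; ring.
rewrite -[RHS]big_mkcond /= -mulr_sumr.
rewrite (bigID (fun b : cube => b i == c)) /=.
rewrite [X in X + _](_ : _ = \sum_(b : cube | b i == c) g b); last first.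
  apply: eq_bigr => b /eqP bi; congr g; apply/ffunP => j; rewrite ffunE.
  by case: eqP => [->|].
rewrite [X in _ + X](_ : _ = \sum_(b : cube | b i == c) g b); last first.
  rewrite [RHS](reindex_inj (inv_inj flipK)) /=; apply: eq_big => [b|b bi].
    by rewrite ffunE eqxx; case: (b i); case: c.
  congr g; apply/ffunP => j; rewrite !ffunE; case: eqP => [//|_ //].
  by move: bi; case: (b i); case: c.
by rewrite mulrDl mul1r.
Qed.

(** Compare two bounds for the mean of [exp (sum_i l i * bit_sign (b i))] under the density [g / p].
    Jensen bounds it below by [exp (4 sum_i l i ^ 2)]. As [g <= 1], it is at most the uniform mean
    over [p], a product of hyperbolic cosines bounded by [exp (2 sum_i l i ^ 2)]. *)
Lemma cube_level1 g : (forall b, 0 <= g b <= 1) -> 0 < cube_avg g ->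
  cube_avg g * expR (\sum_i (bit_corr g i / cube_avg g) ^+ 2 / 8) <= 1.
Proof.
move=> g01 p0; set p := cube_avg g in p0 *.
pose l i := bit_corr g i / p / 4.
have l2 i : `|l i| <= 1 / 2.
  have h : `|bit_corr g i| <= p by apply: bit_corr_le => b; case/andP: (g01 b).
  rewrite /l; move: (bit_corr g i) h => c h; rewrite !normrM !normfV (gtr0_norm p0) [`|4|]ger0_norm//.
  by rewrite ler_pdivrMr// ler_pdivrMr//; lra.
pose w b := g b / 2 ^+ m / p.
have w0 b : 0 <= w b.
  by case/andP: (g01 b) => ? _; rewrite /w divr_ge0 ?(ltW p0)// divr_ge0 ?exprn_ge0.
have w1 : \sum_b w b = 1.
  by rewrite -!mulr_suml -/(cube_avg g) -/p divff// gt_eqF.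
have := expR_jensen (fun b => \sum_i l i * bit_sign (b i)) w0 w1.
have -> : \sum_b w b * (\sum_i l i * bit_sign (b i)) = 4 * \sum_i l i ^+ 2.
  under eq_bigr do rewrite mulr_sumr; rewrite exchange_big mulr_sumr /=.
  apply: eq_bigr => i _.
  rewrite (_ : 4 * _ = l i * (bit_corr g i / p)); last by rewrite /l; field; rewrite gt_eqF.
  rewrite /bit_corr /cube_avg !(mulr_sumr, mulr_suml); apply: eq_bigr => b _.
  by rewrite /w; field; rewrite gt_eqF ?expf_neq0//= .
have : \sum_b w b * expR (\sum_i l i * bit_sign (b i)) <=
    p^-1 * expR (2 * \sum_i l i ^+ 2).
  apply: (@le_trans _ _ (p^-1 * \prod_i ((expR (l i) + expR (- l i)) / 2))).
    have -> : \prod_i ((expR (l i) + expR (- l i)) / 2) =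
        (\sum_(b : cube) expR (\sum_i l i * bit_sign (b i))) / 2 ^+ m.
      rewrite big_split /= prodr_const card_ord exprVn; congr (_ / _).
      under [RHS]eq_bigr do rewrite expR_sum.
      rewrite -(bigA_distr_bigA (fun i c => expR (l i * bit_sign c))) /=.
      by apply: eq_bigr => i _; rewrite big_bool /= mulr1 mulrN1.
    rewrite mulr_suml mulr_sumr; apply: ler_sum => b _.
    rewrite [leLHS]mulrC [leRHS]mulrCA ler_wpM2l ?expR_ge0// /w.
    rewrite [leRHS]mulrC -mulrA; case/andP: (g01 b) => _; apply: ler_piMl.
    by rewrite mulr_ge0 ?invr_ge0 ?exprn_ge0// ltW.
  rewrite ler_wpM2l ?invr_ge0 ?(ltW p0)// mulr_sumr expR_sum.
  by apply: ler_prod => i _; rewrite cosh_le// divr_ge0// addr_ge0// expR_ge0.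
set L := \sum_i l i ^+ 2 => h1 /le_trans/(_ h1).
have -> : \sum_i (bit_corr g i / p) ^+ 2 / 8 = 2 * L.
  by rewrite mulr_sumr; apply: eq_bigr => i _; rewrite /l; field; rewrite gt_eqF.
rewrite (_ : 4 * L = 2 * L + 2 * L); last by ring.
rewrite expRD ler_pM2r ?expR_gt0// => h.
by rewrite mulrC -ler_pdivlMr// div1r.
Qed.

(** The level-1 inequality gives [p t * exp (Q t) <= 1] for each outcome. Summing over [t] and
    applying Jensen with the weights [p t] bounds the mean of [Q] by the logarithm of the number of
    outcomes. [sqrt_diff_le] converts [Q] into squared differences of square roots. *)
Lemma cube_hellinger (T : finType) (g : T -> cube -> R) (c : R) :
  (forall t b, 0 <= g t b) -> (forall b, \sum_t g t b = 1) ->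
  #|T|%:R <= expR c ->
  \sum_t \sum_i (Num.sqrt (cube_avg (fun b => g t (set_bit b i true)))
     - Num.sqrt (cube_avg (fun b => g t (set_bit b i false)))) ^+ 2 <= 16 * c.
Proof.
move=> g0 g1 Tc.
pose p t := cube_avg (g t).
have p0 t : 0 <= p t by exact: cube_avg_ge0.
have p1 : \sum_t p t = 1.
  by rewrite cube_avg_sum -cube_avg1; congr cube_avg; apply/funext.
pose Q t := \sum_i (bit_corr (g t) i / p t) ^+ 2 / 8.
have gle t b : 0 <= g t b <= 1.
  rewrite g0 /= -(g1 b) (bigD1 t)//= lerDl.
  by apply: sumr_ge0 => ? _; exact: g0.
have : \sum_t p t * Q t <= c.
  rewrite -ler_expR; apply: le_trans (expR_jensen _ p0 p1) _.
  apply: le_trans Tc; rewrite -sum1_card natr_sum; apply: ler_sum => t _.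
  have [->|pt] := eqVneq (p t) 0; first by rewrite mul0r.
  by apply: cube_level1 => //; rewrite lt_neqAle eq_sym pt p0.
move=> h; apply: le_trans (_ : 16 * (\sum_t p t * Q t) <= _); last lra.
rewrite mulr_sumr; apply: ler_sum => t _.
rewrite /Q !mulr_sumr; apply: ler_sum => i _.
rewrite !cube_avg_set_bit /= mul1r mulN1r.
apply: le_trans (sqrt_diff_le _) _; first exact: bit_corr_le.
by rewrite -/(p t); lra.
Qed.

End Cube.

(** * Transcripts and the Hellinger kernel *)

(** [n] exchanged bits followed by one bit for the answer, so that the answer can be read off the
    transcript. *)
Fixpoint transcript (n : nat) : finType :=
  if n is n'.+1 then (bool * transcript n')%type else bool.

Lemma card_transcript n : #|transcript n| = (2 ^ n.+1)%N.
Proof.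
elim: n => [|n IH]; first exact: card_bool.
by rewrite [LHS]card_prod card_bool IH -expnS.
Qed.

(** Each message depends on one party's input and the past, so the inputs producing a given
    transcript form a rectangle. *)
Lemma protocol_rectangles (A B : Type) n (p : protocol A B) : (cost p <= n)%N ->
  exists (tr : A -> B -> transcript n) (al : A -> transcript n -> bool)
         (be : B -> transcript n -> bool) (out : transcript n -> bool),
    (forall x y t, (tr x y == t) = al x t && be y t) /\
    (forall x y, answer p x y = out (tr x y)).
Proof.
elim: n p => [|n IH] p.
  case: p => //= o _.
  - by exists (fun x _ => o x), (fun x t => o x == t), (fun _ _ => true), id;
      split=> // x y t; rewrite andbT.
  - by exists (fun _ y => o y), (fun _ _ => true), (fun y t => o y == t), id; split.
case: p => [ans|ans|bit next|bit next] cp.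
- have [tr [al [be [out [h1 h2]]]]] := IH (AliceAnswers B ans) (leq0n _).
  (* A leaf reached early is padded with the bit [true]. *)
  exists (fun x y => (true, tr x y)), (fun x t => t.1 && al x t.2),
    (fun y t => be y t.2), (fun t => out t.2); split=> // x y [c t] /=.
  by rewrite xpair_eqE h1 eq_sym eqb_id andbA.
- have [tr [al [be [out [h1 h2]]]]] := IH (BobAnswers A ans) (leq0n _).
  exists (fun x y => (true, tr x y)), (fun x t => t.1 && al x t.2),
    (fun y t => be y t.2), (fun t => out t.2); split=> // x y [c t] /=.
  by rewrite xpair_eqE h1 eq_sym eqb_id andbA.
- have {cp}cn c : (cost (next c) <= n)%N.
    by move: cp; rewrite ltnS geq_max => /andP[]; case: c.
  have /boolp.choice[tr trP] := fun c => IH _ (cn c).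
  have /boolp.choice[al {}/boolp.choice[be {}/boolp.choice[out h]]] := trP.
  exists (fun x y => (bit x, tr (bit x) x y)),
    (fun x t => (bit x == t.1) && al t.1 x t.2),
    (fun y t => be t.1 y t.2), (fun t => out t.1 t.2); split=> [x y [c t]|x y] /=.
    by rewrite xpair_eqE; case: eqP => //= <-; rewrite (h _).1.
  exact: (h _).2.
- have {cp}cn c : (cost (next c) <= n)%N.
    by move: cp; rewrite ltnS geq_max => /andP[]; case: c.
  have /boolp.choice[tr trP] := fun c => IH _ (cn c).
  have /boolp.choice[al {}/boolp.choice[be {}/boolp.choice[out h]]] := trP.
  exists (fun x y => (bit y, tr (bit y) x y)),
    (fun x t => al t.1 x t.2), (fun y t => (bit y == t.1) && be t.1 y t.2),
    (fun t => out t.1 t.2); split=> [x y [c t]|x y] /=.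
    rewrite xpair_eqE; case: eqP => //= [<-|]; last by rewrite andbF.
    by rewrite (h _).1.
  exact: (h _).2.
Qed.

(** Disjoint sets of coordinates are independent: exchanging the coordinates outside [S] between two
    points [u] and [v] turns [F u * G v] into [F u * G u]. *)
Lemma cube_avg_indep (R : realType) m (S : pred 'I_m)
    (F G : {ffun 'I_m -> bool} -> R) :
  (forall b b' : {ffun 'I_m -> bool}, (forall i, S i -> b i = b' i) -> F b = F b') ->
  (forall b b' : {ffun 'I_m -> bool}, (forall i, ~~ S i -> b i = b' i) -> G b = G b') ->
  cube_avg (fun b => F b * G b) = cube_avg F * cube_avg G.
Proof.
move=> FS GS.
pose cube := {ffun 'I_m -> bool}.
pose mix (u v : cube) : cube := [ffun i => if S i then u i else v i].
pose phi (u : cube * cube) := (mix u.1 u.2, mix u.2 u.1).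
have phiK : involutive phi.
  by case=> u v; congr pair; apply/ffunP => i; rewrite !ffunE; case: (S i).
have m0 : (2 : R) ^+ m != 0 by rewrite expf_neq0.
suff e : (\sum_b F b) * (\sum_b G b) = 2 ^+ m * \sum_b F b * G b.
  by rewrite /cube_avg mulrACA e; field.
rewrite mulr_suml; under eq_bigr do rewrite mulr_sumr.
rewrite pair_bigA /= (reindex_inj (inv_inj phiK)) /=.
transitivity (\sum_(u : cube * cube) F u.1 * G u.1).
  apply: eq_bigr => -[u v] _ /=; congr (_ * _).
    by apply: FS => i Si; rewrite ffunE Si.
  by apply: GS => i /negPf Si; rewrite ffunE Si.
rewrite -(pair_bigA _ (fun u v => F u * G u)) /= mulr_sumr.
apply: eq_bigr => u _; rewrite sumr_const card_ffun card_bool card_ord.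
by rewrite -[LHS]mulr_natl natrX.
Qed.

(** * Product laws and resampling of one coordinate *)

Section Resampling.
Variables (R : realType) (T : finType) (m : nat) (nu : T -> R).
Hypothesis nu1 : \sum_t nu t = 1.
Local Notation profile := {ffun 'I_m -> T}.

Definition iid (f : profile) : R := \prod_i nu (f i).

Lemma iid_ge0 f : (forall t, 0 <= nu t) -> 0 <= iid f.
Proof. by move=> nu0; exact: prodr_ge0. Qed.

Lemma sum_iid : \sum_f iid f = 1.
Proof.
rewrite -(bigA_distr_bigA (fun _ t => nu t)) /=.
by rewrite big1 // => i _; exact: nu1.
Qed.

(** Exchanging [f i] with an independent fresh sample [t] preserves the product law, and [F] does
    not see coordinate [i] of its profile. *)
Lemma iid_resample (i : 'I_m) (F : T -> profile -> R) :
  (forall t (f f' : profile), (forall j, j != i -> f j = f' j) -> F t f = F t f') ->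
  \sum_f iid f * F (f i) f = \sum_t nu t * \sum_f iid f * F t f.
Proof.
move=> Fi.
pose upd (f : profile) t : profile := [ffun j => if j == i then t else f j].
pose phi (u : T * profile) := (u.2 i, upd u.2 u.1).
have phiK : involutive phi.
  case=> t f; rewrite /phi /= ffunE eqxx; congr pair.
  by apply/ffunP => j; rewrite !ffunE; case: eqP => [->|].
have wphi u : nu (phi u).1 * iid (phi u).2 = nu u.1 * iid u.2.
  case: u => t f; rewrite /iid /= (bigD1 i) //= [in RHS](bigD1 i) //= ffunE eqxx mulrCA.
  congr (_ * (_ * _)); apply: eq_bigr => j /negPf ji.
  by rewrite ffunE ji.
under [RHS]eq_bigr do rewrite mulr_sumr; rewrite pair_bigA /=.
under [RHS]eq_bigr do rewrite mulrA.
rewrite (reindex_inj (inv_inj phiK)) /=.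
under [RHS]eq_bigr => u _ do rewrite (wphi u).
rewrite -(pair_bigA _ (fun t f => nu t * iid f * F (f i) (upd f t))) /=.
under [RHS]eq_bigr => t _ do under eq_bigr => f _ do rewrite -mulrA.
under [RHS]eq_bigr do rewrite -mulr_sumr.
rewrite -[LHS]mul1r -nu1 mulr_suml; apply: eq_bigr => t _; congr (_ * _).
apply: eq_bigr => f _; congr (_ * _); apply: Fi => j /negPf ji.
by rewrite ffunE ji.
Qed.

Lemma iid_marginal (i : 'I_m) (F : T -> R) :
  \sum_f iid f * F (f i) = \sum_t nu t * F t.
Proof.
rewrite (@iid_resample i (fun t _ => F t))//.
by apply: eq_bigr => t _; rewrite -mulr_suml sum_iid mul1r.
Qed.

End Resampling.

(** * The Hellinger kernel of a randomized family of rectangles *)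

Section HellingerKernel.
Variables (R : realType) (X : Type) (Omega T : finType) (om : Omega -> R).
Variables (a b : Omega -> T -> X -> R) (out : Omega -> T -> bool).
Hypothesis om0 : forall r, 0 <= om r.
Hypothesis om1 : \sum_r om r = 1.
Hypothesis a0 : forall r t x, 0 <= a r t x.
Hypothesis b0 : forall r t x, 0 <= b r t x.
Hypothesis ab1 : forall r x y, \sum_t a r t x * b r t y = 1.

Local Notation P r t x y := (a r t x * b r t y).

Let P0 r t x y : 0 <= P r t x y. Proof. exact: mulr_ge0. Qed.

(** [P r t x y] is the probability of transcript [t] on inputs [(x, y)] under coins [r]. The feature
    vector of [x] consists of the square roots of the law on the diagonal input [(x, x)]. *)
Definition hkernel x y : R :=
  \sum_r om r * \sum_t Num.sqrt (P r t x x) * Num.sqrt (P r t y y).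

Definition hdist2 x y x' y' : R :=
  \sum_r om r * \sum_t (Num.sqrt (P r t x y) - Num.sqrt (P r t x' y')) ^+ 2.

Definition close_prob x y : R :=
  \sum_r om r * \sum_t (out r t)%:R * P r t x y.

Lemma psd_hkernel : psd hkernel.
Proof.
split=> [x y|s].
  by apply: eq_bigr => r _; congr (_ * _); apply: eq_bigr => t _; rewrite mulrC.
rewrite (_ : \sum_(u <- s) _ = \sum_r om r * \sum_t
   (\sum_(u <- s) u.1 * Num.sqrt (P r t u.2 u.2)) ^+ 2).
  by apply: sumr_ge0 => r _; rewrite mulr_ge0// sumr_ge0// => t _; exact: sqr_ge0.
under eq_bigr do under eq_bigr do rewrite mulr_sumr.
under eq_bigr do rewrite exchange_big /=.
rewrite exchange_big /=; apply: eq_bigr => r _.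
under eq_bigr do under eq_bigr do rewrite mulrCA mulr_sumr.
under eq_bigr do rewrite -mulr_sumr exchange_big /=.
rewrite -mulr_sumr exchange_big /=; congr (_ * _); apply: eq_bigr => t _.
rewrite sum_sqr_seq; apply: eq_bigr => u _; apply: eq_bigr => v _.
exact: mulrACA.
Qed.

Lemma hkernel_diag x : hkernel x x = 1.
Proof.
rewrite -om1; apply: eq_bigr => r _; rewrite -[RHS]mulr1 -(ab1 r x x).
by congr (_ * _); apply: eq_bigr => t _; rewrite -expr2 sqr_sqrtr.
Qed.

(* Rectangles satisfy [P x x * P y y = P x y * P y x]: on transcripts that
   answer "close" the kernel is controlled by the pairs [(x, y)], [(y, x)], on
   the other ones by [(x, x)], [(y, y)]. *)
Lemma hkernel_le x y : hkernel x y <=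
  (close_prob x y + close_prob y x + (1 - close_prob x x)
    + (1 - close_prob y y)) / 2.
Proof.
rewrite -[X in X - close_prob x x](hkernel_diag x).
rewrite -[X in X - close_prob y y](hkernel_diag y).
rewrite mulrC -!sumrB -!big_split /= mulr_sumr; apply: ler_sum => r _.
rewrite -!mulrBr -!mulrDr mulrCA ler_wpM2l// -!sumrB -!big_split /= mulr_sumr.
apply: ler_sum => t _.
rewrite -!expr2 !sqr_sqrtr//.
have amgm (u v : R) : 0 <= u -> 0 <= v -> Num.sqrt u * Num.sqrt v <= (u + v) / 2.
  move=> u0 v0; have := sqr_ge0 (Num.sqrt u - Num.sqrt v).
  by rewrite sqrrB !sqr_sqrtr//; lra.
case: (out r t); rewrite /= ?(mulr0n, mulr1n) ?(mul0r, mul1r).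
  rewrite -sqrtrM// mulrACA [b _ _ x * _]mulrC mulrACA sqrtrM//.
  have := amgm _ _ (P0 r t x y) (P0 r t y x); lra.
have := amgm _ _ (P0 r t x x) (P0 r t y y); lra.
Qed.

Lemma kdist_hkernel_le x y :
  kdist hkernel x y <= 2 * (hdist2 x y x x + hdist2 x y y y).
Proof.
rewrite /kdist -big_split /= mulr_sumr -sumrB -big_split /= mulr_sumr.
apply: ler_sum => r _; rewrite -mulrDr mulrCA -mulrBr -mulrDr mulrCA.
rewrite ler_wpM2l// -big_split mulr_sumr /= -sumrB -big_split /= mulr_sumr.
apply: ler_sum => t _.
(* Parallelogram identity: the mixed input [(x, y)] serves as a midpoint between [(x, x)] and
   [(y, y)]. *)
have := sqr_ge0 (2 * Num.sqrt (P r t x y) - Num.sqrt (P r t x x)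
  - Num.sqrt (P r t y y)).
nra.
Qed.

End HellingerKernel.

(** * Reduction to finitely many coins *)

Lemma measure_fin_fibers (R : realType) (d : measure_display)
    (Omega : measurableType d) (P : probability Omega R) (W : finType)
    (pat : Omega -> W) (r : seq W) :
  (forall v, measurable [set w | pat w = v]) -> uniq r ->
  measurable [set w | pat w \in r] /\
  P [set w | pat w \in r] = (\sum_(v <- r) P [set w | pat w = v])%E.
Proof.
move=> mp; elim: r => [_|v r IH /=/andP[vr /IH[mr Pr]]].
  rewrite big_nil (_ : [set _ | _] = set0) ?measure0//.
  by apply/seteqP; split=> w //=.
have -> : [set w | pat w \in v :: r] = [set w | pat w = v] `|` [set w | pat w \in r].
  apply/seteqP; split=> w /=; rewrite inE.
    by case/orP => [/eqP|]; [left|right].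
  by case=> [->|->]; rewrite ?eqxx ?orbT.
split; first exact: measurableU.
rewrite big_cons -Pr measureU//.
by apply/seteqP; split=> w //= [->]; apply/negP.
Qed.

(* Only the answers are random variables, so the protocols are grouped by the
   table of their answers on the given inputs. *)
Lemma finite_public_coin (R : realType) (X : normedModType R) (D : R) (s : nat)
    (J : finType) (a b : J -> X) : has_DTEP_protocol X D s ->
  exists (W : finType) (q : W -> R) (p : W -> protocol X X),
  [/\ forall w, 0 <= q w,
      \sum_w q w = 1,
      forall w, (cost (p w) <= s)%N,
      forall j, `|a j - b j| <= 1 ->
        9 / 10 <= \sum_w q w * (answer (p w) (a j) (b j))%:R &
      forall j, D < `|a j - b j| ->
        \sum_w q w * (answer (p w) (a j) (b j))%:R <= 1 / 10].
Proof.
move=> [d [T [P [p [cp mp pclose pfar]]]]].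
have mans j c : measurable [set w | answer (p w) (a j) (b j) = c].
  by rewrite -[X in measurable X]setTI; exact: (mp (a j) (b j) measurableT [set c]).
pose W := {ffun J -> bool}.
pose pat w : W := [ffun j => answer (p w) (a j) (b j)].
have mpat v : measurable [set w | pat w = v].
  have -> : [set w | pat w = v] =
      \bigcap_(j in [set: J]) [set w | answer (p w) (a j) (b j) = v j].
    apply/seteqP; split=> w /= h; first by move=> j _ /=; rewrite -h ffunE.
    by apply/ffunP => j; rewrite ffunE; exact: h.
  by apply: fin_bigcap_measurable => // j _; exact: mans.
have sumE (Q : pred W) : P [set w | Q (pat w)] =
    (\sum_(v | Q v) fine (P [set w | pat w = v]))%:E.
  have [_] := measure_fin_fibers P mpat (enum_uniq Q).
  rewrite big_enum /= => e; rewrite -sumEFin.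
  transitivity (P [set w | pat w \in enum Q]).
    by congr (P _); apply/seteqP; split=> w /=; rewrite mem_enum.
  rewrite e; apply: eq_bigr => v _; rewrite fineK//; exact: fin_num_measure.
(* One protocol represents each answer table. A table that never occurs has probability 0 and gets a
   constant protocol. *)
have /boolp.choice[rep repP] : forall v : W, exists c : protocol X X,
    (cost c <= s)%N /\ ((exists w, pat w = v) ->
      forall j, answer c (a j) (b j) = v j).
  move=> v; have [[w wv]|nw] := pselect (exists w, pat w = v).
    by exists (p w); split=> // _ j; rewrite -wv ffunE.
  by exists (AliceAnswers X (fun=> true)).
pose q v := fine (P [set w | pat w = v]).
have qP v j : q v * (answer (rep v) (a j) (b j))%:R = if v j then q v else 0.
  have [wv|nw] := pselect (exists w, pat w = v).
    by rewrite (repP v).2//; case: (v j); rewrite ?mulr1 ?mulr0.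
  have -> : q v = 0.
    rewrite /q (_ : [set w | _] = set0) ?measure0//.
    by apply/seteqP; split=> w //= wv; case: nw; exists w.
  by rewrite mul0r if_same.
have closeE j : (\sum_v q v * (answer (rep v) (a j) (b j))%:R)%:E =
    P [set w | answer (p w) (a j) (b j) = true].
  under eq_bigr do rewrite qP.
  rewrite -big_mkcond -(sumE (fun v => v j)); congr (P _).
  by apply/seteqP; split=> w /=; rewrite ffunE.
have q1 : \sum_v q v = 1.
  apply: EFin_inj; rewrite -(sumE predT) -(@probability_setT _ _ _ P).
  by congr (P _); apply/seteqP; split.
exists W, q, rep; split=> [v||v|j /pclose|j /pfar h]; rewrite ?(repP _).1//.
- exact: fine_ge0.
- by rewrite -closeE lee_fin.
have : ((9 / 10)%:E + (\sum_v q v * (answer (rep v) (a j) (b j))%:R)%:E <= 1%:E :> \bar R)%E.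
  rewrite closeE; apply: le_trans (leeD2r _ h) _.
  rewrite -measureU.
  - by apply: probability_le1; apply: measurableU; exact: mans.
  - exact: mans.
  - exact: mans.
  - by apply/seteqP; split=> w //= [-> ].
by rewrite -EFinD lee_fin; lra.
Qed.

(** * The hard distribution *)

Section HardInstance.
Variables (R : realType) (X : normedModType R) (D : R) (s : nat).
Variables (I : finType) (pt : I -> X) (mu : I * I -> R) (m' : nat).
Local Notation m := m'.+1.
Local Notation dist := (\sum_u mu u * `|pt u.1 - pt u.2|).
Hypothesis mu0 : forall u, 0 <= mu u.
Hypothesis mu1 : \sum_u mu u = 1.
Hypothesis s0 : (0 < s)%N.
Hypothesis D1 : 1 < D.
Hypothesis m's : m'%:R * dist <= s%:R.

(* A coordinate of the hard distribution is a pair [(x, y)] drawn from [mu] and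
   a fair coin naming the party whose input is randomized: given the coordinate,
   the hidden bit [true] stands for [(x, y)] and [false] for [(x, x)] or
   [(y, y)], so the inputs of the two parties are independent. *)
Local Notation coord := (I * I * bool)%type.
Local Notation profile := {ffun 'I_m -> coord}.
Local Notation cube := {ffun 'I_m -> bool}.

Let nu (u : coord) : R := mu u.1 / 2.
Let alice (u : coord) (c : bool) : X := pt (if u.2 && ~~ c then u.1.2 else u.1.1).
Let bob (u : coord) (c : bool) : X := pt (if ~~ u.2 && ~~ c then u.1.1 else u.1.2).
Let gap (u : coord) : R := `|pt u.1.1 - pt u.1.2|.
(** The expected total [slack] is at most [s], hence at most 1/10 after division by [L]. *)
Let L : R := 10 * s%:R.

(** Slot [i] receives the actual input, and the other slots are filled from the hard
    distribution. *)
Let ain (i : 'I_m) (f : profile) (c : cube) (x : X) : X :=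
  L^-1 *: (x + \sum_(j | j != i) alice (f j) (c j)).
Let bin (i : 'I_m) (f : profile) (c : cube) (y : X) : X :=
  L^-1 *: (y + \sum_(j | j != i) bob (f j) (c j)).
Let slack (i : 'I_m) (f : profile) : R := \sum_(j | j != i) gap (f j).

Let L0 : 0 < L. Proof. by rewrite mulr_gt0// ltr0n. Qed.

Let nu0 u : 0 <= nu u. Proof. by rewrite divr_ge0. Qed.

Let nuE (F : coord -> R) :
  \sum_u nu u * F u = (\sum_v mu v * (F (v, true) + F (v, false))) / 2.
Proof.
transitivity (\sum_(u : coord) nu (u.1, u.2) * F (u.1, u.2)).
  by apply: eq_bigr => -[].
rewrite -(pair_bigA _ (fun v c => nu (v, c) * F (v, c))) /= mulr_suml.
by apply: eq_bigr => v _; rewrite big_bool /nu /=; field.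
Qed.

Let nu1 : \sum_u nu u = 1.
Proof.
have := nuE (fun=> 1); under eq_bigr do rewrite mulr1.
by move=> ->; rewrite -mulr_suml mu1; field.
Qed.

Let gap_bound u c : `|alice u c - bob u c| <= gap u.
Proof.
by rewrite /alice /bob /gap; case: u => -[i j] [] /=; case: c; rewrite /= ?subrr ?normr0.
Qed.

Let ainB_le i f c x y : `|ain i f c x - bin i f c y - L^-1 *: (x - y)| <= slack i f / L.
Proof.
have e (A B : X) : x + A - (y + B) - (x - y) = A - B.
  by rewrite opprD addrACA [x - y + _]addrC addrK.
rewrite -!scalerBr e -sumrB.
rewrite normrZ gtr0_norm ?invr_gt0// mulrC ler_wpM2r ?invr_ge0 ?(ltW L0)//.
by apply: le_trans (ler_norm_sum _ _ _) _; apply: ler_sum => j _; exact: gap_bound.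
Qed.

Let slack0 i f : 0 <= slack i f / L.
Proof.
by apply: divr_ge0; [apply: sumr_ge0 => j _; exact: normr_ge0|exact: ltW].
Qed.

Let slack_avg i : \sum_f iid nu f * slack i f <= s%:R.
Proof.
apply: le_trans m's; under eq_bigr do rewrite mulr_sumr.
rewrite exchange_big /=.
under eq_bigr => j _ do rewrite (iid_marginal nu1 j gap).
rewrite sumr_const (_ : #|_| = m').
  rewrite nuE mulr_natl [X in X *+ _](_ : _ = dist)//.
  by rewrite mulr_suml; apply: eq_bigr => v _; rewrite /gap /=; field.
by have := cardC1 i; rewrite card_ord.
Qed.

(** * The kernel of a finite protocol run on the hard distribution *)

Section Protocol.
Variables (W : finType) (q : W -> R) (p : W -> protocol X X).
Hypothesis q0 : forall w, 0 <= q w.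
Hypothesis q1 : \sum_w q w = 1.
Variables (tr : W -> X -> X -> transcript s) (al be : W -> X -> transcript s -> bool).
Variable (out : W -> transcript s -> bool).
Hypothesis trE : forall w x y t, (tr w x y == t) = al w x t && be w y t.
Hypothesis outE : forall w x y, answer (p w) x y = out w (tr w x y).

Local Notation coins := (W * 'I_m * profile)%type.
Let om (r : coins) : R := q r.1.1 / m%:R * iid nu r.2.
Let pa (r : coins) t x : R :=
  cube_avg (fun c => (al r.1.1 (ain r.1.2 r.2 c x) t)%:R).
Let pb (r : coins) t y : R :=
  cube_avg (fun c => (be r.1.1 (bin r.1.2 r.2 c y) t)%:R).
Let acc (r : coins) t := out r.1.1 t.

Let sum_coins (F : W -> 'I_m -> profile -> R) :
  \sum_r om r * F r.1.1 r.1.2 r.2 =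
  (\sum_i \sum_f iid nu f * \sum_w q w * F w i f) / m%:R.
Proof.
rewrite /om -(pair_bigA _ (fun wi f => q wi.1 / m%:R * iid nu f * F wi.1 wi.2 f)).
rewrite -(pair_bigA _ (fun w i => \sum_f q w / m%:R * iid nu f * F w i f)) /=.
rewrite exchange_big /= mulr_suml; apply: eq_bigr => i _.
rewrite exchange_big /= mulr_suml; apply: eq_bigr => f _.
rewrite mulr_sumr mulr_suml; apply: eq_bigr => w _; ring.
Qed.

Let om0 r : 0 <= om r.
Proof. by rewrite mulr_ge0 ?divr_ge0 ?iid_ge0. Qed.

Let om1 : \sum_r om r = 1.
Proof.
have := sum_coins (fun _ _ _ => 1); under eq_bigr do rewrite mulr1.
move=> ->; under eq_bigr do under eq_bigr do under eq_bigr do rewrite mulr1.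
under eq_bigr do under eq_bigr do rewrite q1 mulr1.
under eq_bigr do rewrite (sum_iid _ nu1).
by rewrite sumr_const card_ord divff// pnatr_eq0.
Qed.

Let pa0 r t x : 0 <= pa r t x. Proof. by apply: cube_avg_ge0 => c. Qed.
Let pb0 r t x : 0 <= pb r t x. Proof. by apply: cube_avg_ge0 => c. Qed.

(** Given the profile, each hidden bit influences only one party. Averaging over the bits therefore
    keeps the product form of the rectangles. *)
Let papb r t x y : pa r t x * pb r t y =
  cube_avg (fun c => (tr r.1.1 (ain r.1.2 r.2 c x) (bin r.1.2 r.2 c y) == t)%:R).
Proof.
rewrite -(@cube_avg_indep _ _ (fun j => (r.2 j).2)).
- by congr cube_avg; apply/funext => c; rewrite trE -natrM mulnb.
- move=> c c' cc'; rewrite (_ : ain r.1.2 r.2 c x = ain r.1.2 r.2 c' x)//.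
  congr (_ *: (_ + _)); apply: eq_bigr => j _; rewrite /alice.
  by case: ((r.2 j).2) (cc' j) => //= ->.
- move=> c c' cc'; rewrite (_ : bin r.1.2 r.2 c y = bin r.1.2 r.2 c' y)//.
  congr (_ *: (_ + _)); apply: eq_bigr => j _; rewrite /bob.
  by case: ((r.2 j).2) (cc' j) => //= ->.
Qed.

Let papb1 r x y : \sum_t pa r t x * pb r t y = 1.
Proof.
under eq_bigr do rewrite papb.
rewrite cube_avg_sum -[RHS](cube_avg1 R m); congr cube_avg; apply/funext => c.
rewrite (bigD1 (tr r.1.1 (ain r.1.2 r.2 c x) (bin r.1.2 r.2 c y)))//= eqxx.
by rewrite big1 ?addr0// => t /negPf; rewrite eq_sym => ->.
Qed.

Definition hard_kernel : X -> X -> R := hkernel om pa pb.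

Let close_probE x y : close_prob om pa pb acc x y =
  (\sum_i \sum_f iid nu f * cube_avg (fun c =>
     \sum_w q w * (answer (p w) (ain i f c x) (bin i f c y))%:R)) / m%:R.
Proof.
rewrite /close_prob (sum_coins (fun w i f => \sum_t (out w t)%:R *
  (pa (w, i, f) t x * pb (w, i, f) t y))) /=.
congr (_ / _); apply: eq_bigr => i _; apply: eq_bigr => f _; congr (_ * _).
rewrite -cube_avg_sum; apply: eq_bigr => w _.
under eq_bigr do rewrite papb /cube_avg /= mulrA mulr_sumr.
rewrite -mulr_suml exchange_big /= /cube_avg mulrA mulr_sumr.
congr (_ / _); apply: eq_bigr => c _; congr (_ * _).
rewrite outE (bigD1 (tr w (ain i f c x) (bin i f c y)))//= eqxx mulr1.
by rewrite big1 ?addr0// => t /negPf; rewrite eq_sym => ->; rewrite mulr0.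
Qed.

Let avg_slack e : (\sum_i \sum_f iid nu f * (e + slack i f / L)) / m%:R <= e + 1 / 10.
Proof.
rewrite ler_pdivrMr ?ltr0n// mulr_natr -[X in _ *+ X](card_ord m) -sumr_const.
apply: ler_sum => i _; under eq_bigr do rewrite mulrDr mulrA.
rewrite big_split -!mulr_suml (sum_iid _ nu1) mul1r lerD2l.
rewrite ler_pdivrMr//; apply: le_trans (slack_avg i) _.
by rewrite /L; lra.
Qed.

Let cube_avg_cst (e : R) : cube_avg (fun _ : cube => e) = e.
Proof.
have := cube_avg1 R m; rewrite /cube_avg !sumr_const => h.
by rewrite -[e]mulr1 -mulrnAr -mulrA h.
Qed.

Hypothesis close_ok : forall i f c v, `|ain i f c (pt v) - bin i f c (pt v)| <= 1 ->
  9 / 10 <= \sum_w q w * (answer (p w) (ain i f c (pt v)) (bin i f c (pt v)))%:R.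
Hypothesis far_ok : forall i f c v v', D < `|ain i f c (pt v) - bin i f c (pt v')| ->
  \sum_w q w * (answer (p w) (ain i f c (pt v)) (bin i f c (pt v')))%:R <= 1 / 10.

(** Pointwise, acceptance is at most [1 / 10 + slack / L]: the scaled points are at distance at
    least [2 D], so either the inputs fed to the protocol are still far, or [slack / L >= D > 1]. *)
Let close_prob_far v v' : 20 * (s%:R * D) <= `|pt v - pt v'| ->
  close_prob om pa pb acc (pt v) (pt v') <= 1 / 5.
Proof.
move=> vv'; rewrite close_probE (_ : 1 / 5 = 1 / 10 + 1 / 10); last by field.
apply: le_trans (avg_slack _); rewrite ler_wpM2r ?invr_ge0//.
apply: ler_sum => i _; apply: ler_sum => f _; rewrite ler_wpM2l ?iid_ge0//.
rewrite -[leRHS]cube_avg_cst; apply: ler_cube_avg => c.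
have sl0 := slack0 i f.
have [/far_ok far|near] := ltP D `|ain i f c (pt v) - bin i f c (pt v')|.
  by apply: le_trans far _; rewrite lerDl.
have le1 : \sum_w q w * (answer (p w) (ain i f c (pt v)) (bin i f c (pt v')))%:R <= 1.
  rewrite -[leRHS]q1; apply: ler_sum => w _; rewrite ler_piMr ?q0//.
  by case: (answer _ _ _).
have := ainB_le i f c (pt v) (pt v').
have : `|L^-1 *: (pt v - pt v')| <= `|ain i f c (pt v) - bin i f c (pt v')
     - L^-1 *: (pt v - pt v')| + `|ain i f c (pt v) - bin i f c (pt v')|.
  rewrite -{1}[L^-1 *: _](subKr (ain i f c (pt v) - bin i f c (pt v'))).
  by rewrite [leRHS]addrC; exact: ler_normB.
rewrite normrZ gtr0_norm ?invr_gt0//.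
have : 2 * D <= L^-1 * `|pt v - pt v'|.
  rewrite [leRHS]mulrC ler_pdivlMr//; apply: le_trans vv'; rewrite /L; lra.
set S := \sum_w q w * _ in le1 *; set u := slack i f / L.
set d1 := L^-1 * _; set d2 := `|_|; set d3 := `|_| in near *.
have arith (x y z t w : R) : x <= 1 -> t <= D -> 2 * D <= y -> y <= z + t ->
    z <= w -> x <= 1 / 10 + w by move: D1; lra.
exact: arith le1 near.
Qed.

Let close_prob_near v : 1 - close_prob om pa pb acc (pt v) (pt v) <= 1 / 5.
Proof.
rewrite close_probE (_ : 1 / 5 = 1 / 10 + 1 / 10); last by field.
have tot : (\sum_(i < m) \sum_(f : profile) iid nu f) / m%:R = 1.
  under eq_bigr do rewrite (sum_iid _ nu1).
  by rewrite sumr_const card_ord divff// pnatr_eq0.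
apply: le_trans (avg_slack _); rewrite -[X in X - _]tot -mulrBl.
rewrite ler_wpM2r ?invr_ge0// -sumrB.
apply: ler_sum => i _; rewrite -sumrB; apply: ler_sum => f _.
rewrite -[X in X - _]mulr1 -mulrBr ler_wpM2l ?iid_ge0// lerBlDr -lerBlDl.
rewrite -[leLHS]cube_avg_cst; apply: ler_cube_avg => c.
have sl0 := slack0 i f.
have ge0 : 0 <= \sum_w q w * (answer (p w) (ain i f c (pt v)) (bin i f c (pt v)))%:R.
  by apply: sumr_ge0 => w _; rewrite mulr_ge0.
have := ainB_le i f c (pt v) (pt v); rewrite subrr scaler0 subr0 => near.
have [/(le_trans near)/close_ok|] := leP (slack i f / L) 1; lra.
Qed.

(** Each of the four error terms in [hkernel_le] is at most 1/5, which gives 2/5. *)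
Lemma hard_kernel_far v v' : 20 * (s%:R * D) <= `|pt v - pt v'| ->
  hard_kernel (pt v) (pt v') <= 1 / 2.
Proof.
move=> vv'; apply: le_trans (hkernel_le acc om0 om1 pa0 pb0 papb1 _ _) _.
have := close_prob_far vv'; have := @close_prob_far v' v.
rewrite distrC => /(_ vv').
have := close_prob_near v; have := close_prob_near v'; lra.
Qed.

(** Resampling lets the fresh pair [u] play the role of [f i]. For fixed [f] and [w], the slots [i]
    are then the bits of a single cube, and [cube_hellinger] bounds the sum over all of them by
    [32 s]; averaging over [i] divides by [m]. *)
Let hdist_avg : \sum_u nu u * hdist2 om pa pb
    (alice u true) (bob u true) (alice u false) (bob u false)
  <= 32 * s%:R / m%:R.
Proof.
pose H w i f u := \sum_t
  (Num.sqrt (pa (w, i, f) t (alice u true) * pb (w, i, f) t (bob u true))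
  - Num.sqrt (pa (w, i, f) t (alice u false) * pb (w, i, f) t (bob u false))) ^+ 2.
have hE u : hdist2 om pa pb (alice u true) (bob u true) (alice u false) (bob u false)
    = (\sum_i \sum_f iid nu f * \sum_w q w * H w i f u) / m%:R.
  by rewrite -(sum_coins (fun w i f => H w i f u)).
under eq_bigr do rewrite hE mulrA.
rewrite -mulr_suml ler_wpM2r ?invr_ge0//.
under eq_bigr do rewrite mulr_sumr.
rewrite exchange_big /=.
have resample i : \sum_u nu u * \sum_f iid nu f * \sum_w q w * H w i f u =
    \sum_f iid nu f * \sum_w q w * H w i f (f i).
  rewrite -(iid_resample nu1 (i := i) (F := fun u f => \sum_w q w * H w i f u))//.
  move=> u f f' ff'; apply: eq_bigr => w _; congr (_ * _).
  have aE c x : ain i f c x = ain i f' c x.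
    by congr (_ *: (_ + _)); apply: eq_bigr => j ji; rewrite ff'.
  have bE c x : bin i f c x = bin i f' c x.
    by congr (_ *: (_ + _)); apply: eq_bigr => j ji; rewrite ff'.
  have paE t x : pa (w, i, f) t x = pa (w, i, f') t x.
    by congr cube_avg; apply/funext => c; rewrite /= aE.
  have pbE t x : pb (w, i, f) t x = pb (w, i, f') t x.
    by congr cube_avg; apply/funext => c; rewrite /= bE.
  by apply: eq_bigr => t _; rewrite !paE !pbE.
under eq_bigr do rewrite resample.
rewrite exchange_big /=.
rewrite -[leRHS]mul1r -[X in X * _](sum_iid m nu1) mulr_suml; apply: ler_sum => f _.
rewrite -mulr_sumr ler_wpM2l ?iid_ge0// exchange_big /=.
rewrite -[leRHS]mul1r -[X in X * _]q1 mulr_suml; apply: ler_sum => w _.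
rewrite -mulr_sumr ler_wpM2l// exchange_big /=.
pose g t (c : cube) : R := (tr w (L^-1 *: \sum_j alice (f j) (c j))
  (L^-1 *: \sum_j bob (f j) (c j)) == t)%:R.
have gE i t v : cube_avg (fun c => g t (set_bit c i v)) =
    pa (w, i, f) t (alice (f i) v) * pb (w, i, f) t (bob (f i) v).
  rewrite papb /=; congr cube_avg; apply/funext => c; congr (_ == _)%:R.
  congr (tr w _ _); rewrite [X in _ *: X](bigD1 i)//= ffunE eqxx.
    congr (_ *: (_ + _)); apply: eq_bigr => j /negPf ji; by rewrite ffunE ji.
  congr (_ *: (_ + _)); apply: eq_bigr => j /negPf ji; by rewrite ffunE ji.
(* [2 ^ (s + 1) <= e ^ (s + 1) <= e ^ (2 s)], the last step because [s] is positive. *)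
have cardT : #|transcript s|%:R <= expR (2 * s%:R) :> R.
  rewrite card_transcript natrX.
  apply: (@le_trans _ _ (expR 1 ^+ s.+1)).
    by apply: lerXn2r; rewrite ?nnegrE ?expR_ge0//; apply: expR_ge1Dx.
  rewrite -expRM_natl ler_expR mulr1 -natrM ler_nat; lia.
have g0 t c : 0 <= g t c by exact: ler0n.
have g1 c : \sum_t g t c = 1.
  rewrite (bigD1 (tr w (L^-1 *: \sum_j alice (f j) (c j))
    (L^-1 *: \sum_j bob (f j) (c j))))//= /g eqxx.
  by rewrite big1 ?addr0// => t /negPf; rewrite eq_sym => ->.
apply: (@le_trans _ _ (16 * (2 * s%:R))); last by lra.
apply: le_trans (cube_hellinger g0 g1 cardT).
by apply: ler_sum => t _; apply: ler_sum => i _; rewrite !gE.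
Qed.

Lemma hard_kernel_dist :
  \sum_v mu v * kdist hard_kernel (pt v.1) (pt v.2) <= 128 * (s%:R / m%:R).
Proof.
(* Of the factor 4, one 2 comes from [kdist_hkernel_le] and the other from the fair coin choosing
   between [(x, x)] and [(y, y)]. *)
have arith (x : R) : 4 * (32 * x) = 128 * x by ring.
rewrite -arith [32 * _]mulrA.
apply: le_trans (ler_wpM2l _ hdist_avg) => //.
rewrite nuE mulr_suml mulr_sumr; apply: ler_sum => v _.
have := kdist_hkernel_le pa pb om0 (pt v.1) (pt v.2).
rewrite /alice /bob /hard_kernel /=.
by have := mu0 v; nra.
Qed.

Lemma psd_hard_kernel : psd hard_kernel.
Proof. exact: psd_hkernel. Qed.

Lemma hard_kernel_diag x : hard_kernel x x = 1.
Proof. exact: hkernel_diag. Qed.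

End Protocol.

Lemma exists_hard_kernel : has_DTEP_protocol X D s ->
  exists k : X -> X -> R, [/\ psd k, forall x, k x x = 1,
    forall v v', 20 * (s%:R * D) <= `|pt v - pt v'| -> k (pt v) (pt v') <= 1 / 2 &
    \sum_v mu v * kdist k (pt v.1) (pt v.2) <= 128 * (s%:R / m%:R)].
Proof.
move=> prot.
(* [J] indexes all input pairs fed to the protocol. There are finitely many, so the public coin can
   be made finite. *)
pose J := ('I_m * profile * cube * (I * I))%type.
have [W [q [p [q0 q1 cp close far]]]] := finite_public_coin
  (fun j : J => ain j.1.1.1 j.1.1.2 j.1.2 (pt j.2.1))
  (fun j : J => bin j.1.1.1 j.1.1.2 j.1.2 (pt j.2.2)) prot.
have /boolp.choice[tr trP] := fun w => protocol_rectangles (cp w).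
have /boolp.choice[al {}/boolp.choice[be {}/boolp.choice[out h]]] := trP.
have trE w := (h w).1; have outE w := (h w).2.
exists (hard_kernel q al be); split.
- exact: psd_hard_kernel.
- exact: (hard_kernel_diag q1 trE).
- move=> v v'; apply: (hard_kernel_far q0 q1 trE outE) => i f c u.
    exact: (close (i, f, c, (u, u))).
  by move=> u'; exact: (far (i, f, c, (u, u'))).
- exact: (hard_kernel_dist q0 q1 trE).
Qed.

End HardInstance.

(** * From averages to all pairs *)

Section KernelClosure.
Variables (R : realType) (X : Type).
Implicit Types (k : X -> X -> R).

Lemma psd_sum (J : Type) (r : seq J) (w : J -> R) (k : J -> X -> X -> R) :
  (forall j, 0 <= w j) -> (forall j, psd (k j)) ->
  psd (fun x y => \sum_(j <- r) w j * k j x y).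
Proof.
move=> w0 pk; split=> [x y|s]; first by apply: eq_bigr => j _; rewrite (pk j).1.
under eq_bigr do under eq_bigr do rewrite mulr_sumr.
under eq_bigr do rewrite exchange_big /=.
rewrite exchange_big /=; apply: sumr_ge0 => j _.
under eq_bigr do under eq_bigr do rewrite mulrCA.
under eq_bigr do rewrite -mulr_sumr.
by rewrite -mulr_sumr mulr_ge0// (pk j).2.
Qed.

Lemma kdist_sum (J : Type) (r : seq J) (w : J -> R) (k : J -> X -> X -> R) x y :
  kdist (fun x y => \sum_(j <- r) w j * k j x y) x y =
  \sum_(j <- r) w j * kdist (k j) x y.
Proof.
rewrite /kdist mulr_sumr -big_split -sumrB; apply: eq_bigr => j _ /=; ring.
Qed.

Lemma psd_preim (Y : Type) (h : X -> Y) (k : Y -> Y -> R) :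
  psd k -> psd (fun x y => k (h x) (h y)).
Proof.
move=> [sk pk]; split=> [x y|s]; first exact: sk.
have := pk [seq (u.1, h u.2) | u <- s].
by rewrite big_map; under eq_bigr do rewrite big_map.
Qed.

Lemma psd_convex (e : R) k1 k2 : 0 <= e <= 1 -> psd k1 -> psd k2 ->
  psd (fun x y => (1 - e) * k1 x y + e * k2 x y).
Proof.
move=> /andP[e0 e1] p1 p2.
have := @psd_sum bool [:: true; false] (fun c => if c then 1 - e else e)
  (fun c => if c then k1 else k2).
rewrite (_ : (fun x y => \sum_(_ <- _) _) =
  (fun x y => (1 - e) * k1 x y + e * k2 x y)); last first.
  by apply/funext => x; apply/funext => y; rewrite !big_cons big_nil addr0.
by apply; case=> //; lra.
Qed.

End KernelClosure.

Section FiniteKernels.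
Variables (R : realType) (X : normedModType R) (D : R) (s : nat).
Hypothesis s0 : (0 < s)%N.
Hypothesis D1 : 1 < D.
Hypothesis prot : has_DTEP_protocol X D s.

(** * Min-max by approachability on a finite set *)

Section MinMax.
Variables (I : finType) (v0 : I) (pt : I -> X).
Local Notation gap u := `|pt u.1 - pt u.2|.

Let admissible (k : X -> X -> R) := [/\ psd k, forall x, k x x = 1 &
  forall v v', 20 * (s%:R * D) <= `|pt v - pt v'| -> k (pt v) (pt v') <= 1 / 2].

Lemma best_response (mu : I * I -> R) (e : R) : (forall u, 0 <= mu u) -> 0 < e ->
  exists k, admissible k /\
    \sum_u mu u * (kdist k (pt u.1) (pt u.2) - 128 * (gap u + e)) <= 0.
Proof.
move=> mu0 e0.
wlog mu1 : mu mu0 / \sum_u mu u = 1.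
  move=> wl; have [M0|M0] := eqVneq (\sum_u mu u) 0.
    (* For zero weights any admissible kernel will do; a point mass supplies one. *)
    have [] := wl (fun u => (u == (v0, v0))%:R).
    - by move=> u; exact: ler0n.
    - by rewrite (bigD1 (v0, v0))//= eqxx big1 ?addr0// => u /negPf ->.
    move=> k [ak _]; exists k; split=> //.
    have muz u : mu u = 0.
      move/eqP: M0; rewrite psumr_eq0// => /allP/(_ u (mem_index_enum _)).
      by move/eqP.
    by rewrite big1// => u _; rewrite muz mul0r.
  have Mgt0 : 0 < \sum_u mu u by rewrite lt_neqAle eq_sym M0 sumr_ge0.
  have [] := wl (fun u => mu u / \sum_u mu u).
  - by move=> u; rewrite divr_ge0// ltW.
  - by rewrite -mulr_suml divff.
  move=> k [ak]; under eq_bigr do rewrite mulrAC.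
  rewrite -mulr_suml pmulr_lle0 ?invr_gt0// => h.
  by exists k.
set d := \sum_u mu u * (gap u + e).
have dE : d = \sum_u mu u * gap u + e.
  by rewrite /d; under eq_bigr do rewrite mulrDr; rewrite big_split -mulr_suml mu1 mul1r.
have gap0 : 0 <= \sum_u mu u * gap u by apply: sumr_ge0 => u _; rewrite mulr_ge0.
have d0 : 0 < d by rewrite dE; lra.
(* The largest number of hidden pairs with [m' * d <= s]; then [s / (m' + 1) <= d]. The term [e]
   keeps [d] positive. *)
pose m' := Num.truncn (s%:R / d).
have /andP[m1 m2] : m'%:R <= s%:R / d < m'.+1%:R.
  by apply: truncn_itv; rewrite divr_ge0// ltW.
have m1' : m'%:R * (\sum_u mu u * gap u) <= s%:R.
  rewrite ler_pdivlMr// in m1; apply: le_trans m1; rewrite ler_wpM2l// dE; lra.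
have [k [pk k1 kfar kd]] := exists_hard_kernel mu0 mu1 s0 D1 m1' prot.
exists k; split=> //.
under eq_bigr do rewrite mulrBr; rewrite sumrB subr_le0; apply: le_trans kd _.
under eq_bigr do rewrite mulrCA.
rewrite -mulr_sumr -/d ler_wpM2l// ler_pdivrMr ?ltr0n//.
by rewrite ltr_pdivrMr// mulrC in m2; exact: ltW.
Qed.

Lemma admissible_kdist_le k x y : admissible k -> 0 <= kdist k x y <= 4.
Proof.
move=> [pk k1 _]; rewrite kdist_ge0//=; apply: le_trans (kdist_le _ _ pk) _.
by rewrite !k1; lra.
Qed.

(* Blackwell's approachability: the running average of best responses to the
   current violation [Num.max 0 (kdist - c)] has squared violation O(1/n). *)
Lemma approachability (e : R) (n : nat) : 0 < e ->
  let c u := 128 * (gap u + e) in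
  exists k, admissible k /\
    \sum_u Num.max 0 (kdist k (pt u.1) (pt u.2) - c u) ^+ 2 <=
    (\sum_u (4 + c u) ^+ 2) / n.+1%:R.
Proof.
move=> e0 c; set B := \sum_u (4 + c u) ^+ 2.
have c0 u : 0 <= c u by rewrite /c; have := normr_ge0 (pt u.1 - pt u.2); lra.
have dev k : admissible k ->
    \sum_u (kdist k (pt u.1) (pt u.2) - c u) ^+ 2 <= B.
  move=> ak; apply: ler_sum => u _.
  have := admissible_kdist_le (pt u.1) (pt u.2) ak; have := c0 u.
  by move: (kdist _ _ _) (c u) => a b b0 /andP[a0 a4]; nra.
elim: n => [|n [k [ak IH]]].
  have [k [ak _]] := best_response (fun u => lexx 0) e0.
  exists k; split=> //; rewrite divr1; apply: le_trans (dev k ak).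
  apply: ler_sum => u _; move: (kdist _ _ _ - _) => a.
  by rewrite maxEle; case: ifP => _; rewrite ?expr0n ?sqr_ge0.
pose pos u := Num.max 0 (kdist k (pt u.1) (pt u.2) - c u).
have pos0 u : 0 <= pos u by rewrite /pos le_max lexx.
have [k' [ak' resp]] := best_response pos0 e0.
pose t : R := n.+2%:R^-1.
have t01 : 0 <= t <= 1 by rewrite invr_ge0 ler0n invf_le1 ?ltr0n// ler1n.
exists (fun x y => (1 - t) * k x y + t * k' x y); split.
  have [pk k1 kf] := ak; have [pk' k1' kf'] := ak'.
  split; first exact: psd_convex.
    by move=> x; rewrite k1 k1'; ring.
  move=> v v' vv'; have := kf _ _ vv'; have := kf' _ _ vv'.
  by move: (k _ _) (k' _ _) => a b; move: t01 => /andP[]; nra.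
set w := fun u => kdist k' (pt u.1) (pt u.2) - c u.
(* A positive new violation is at most [(1 - t) * pos u + t * w u]. In the expanded square the cross
   term is nonpositive by the choice of [k']. *)
apply: (@le_trans _ _ (\sum_u ((1 - t) * pos u + t * w u) ^+ 2)).
  apply: ler_sum => u _.
  set a := Num.max 0 _.
  have a0 : 0 <= a by rewrite le_max lexx.
  have [->|an] := eqVneq a 0; first by rewrite expr0n sqr_ge0.
  suff : a <= (1 - t) * pos u + t * w u by move=> h; rewrite lerXn2r ?nnegrE ?(le_trans a0 h).
  have aE : a = kdist (fun x y => (1 - t) * k x y + t * k' x y) (pt u.1) (pt u.2) - c u.
    by move: an; rewrite /a maxEle; case: ifP => //; rewrite eqxx.
  have pu : kdist k (pt u.1) (pt u.2) - c u <= pos u by rewrite /pos le_max lexx orbT.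
  rewrite aE /w; move: pu; rewrite /kdist; move: t01 => /andP[t0 t1].
  move: (pos u) (c u) (k _ _) (k _ _) (k _ _) (k' _ _) (k' _ _) (k' _ _).
  by move=> p c' a1 a2 a3 b1 b2 b3; nra.
have -> : \sum_u ((1 - t) * pos u + t * w u) ^+ 2 =
   (1 - t) ^+ 2 * (\sum_u pos u ^+ 2) + 2 * t * (1 - t) * (\sum_u pos u * w u)
   + t ^+ 2 * (\sum_u w u ^+ 2).
  by rewrite !mulr_sumr -!big_split; apply: eq_bigr => u _ /=; ring.
have h2 : \sum_u pos u * w u <= 0 by [].
have h3 := dev k' ak'; rewrite -/w in h3.
have tE : t = n.+2%:R^-1 by [].
(* With [t = 1 / (n + 2)] this equals [B / (n + 2)] exactly. *)
apply: (@le_trans _ _ ((1 - t) ^+ 2 * (B / n.+1%:R) + t ^+ 2 * B)).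
  rewrite lerD//; last by rewrite ler_wpM2l ?sqr_ge0.
  rewrite -[leRHS]addr0 lerD//; first by rewrite ler_wpM2l ?sqr_ge0.
  by move: t01 => /andP[t0 t1]; rewrite mulr_ge0_le0// mulr_ge0 ?subr_ge0// mulr_ge0.
rewrite le_eqVlt; apply/orP; left; apply/eqP; rewrite tE -natr1.
have : n.+1%:R != 0 :> R by rewrite pnatr_eq0.
have : n.+1%:R + 1 != 0 :> R by rewrite natr1 pnatr_eq0.
by move: (n.+1%:R) => N N1 N0; field; rewrite N1 N0.
Qed.

Lemma near_optimal_kernel (e : R) : 0 < e -> exists k, admissible k /\
  forall v v', kdist k (pt v) (pt v') <= 128 * (`|pt v - pt v'| + e) + e.
Proof.
move=> e0; set B := \sum_(u : I * I) (4 + 128 * (gap u + e)) ^+ 2.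
have B0 : 0 <= B by apply: sumr_ge0 => u _; exact: sqr_ge0.
pose n := Num.truncn (B / e ^+ 2).
have nB : B / n.+1%:R <= e ^+ 2.
  rewrite ler_pdivrMr ?ltr0n// mulrC -ler_pdivrMr ?exprn_gt0//.
  have /andP[_ /ltW] // : n%:R <= B / e ^+ 2 < n.+1%:R.
  by apply: truncn_itv; rewrite divr_ge0// sqr_ge0.
have [k [ak kn]] := approachability n e0.
exists k; split=> // v v'.
have {}kn := le_trans kn nB.
rewrite (bigD1 (v, v')) //= in kn.
have {}kn : Num.max 0 (kdist k (pt v) (pt v') - 128 * (`|pt v - pt v'| + e)) ^+ 2 <= e ^+ 2.
  by apply: le_trans kn; rewrite lerDl; apply: sumr_ge0 => u _; exact: sqr_ge0.
rewrite ler_pXn2r ?nnegrE ?(ltW e0)// in kn; last by rewrite le_max lexx.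
by move: kn; rewrite ge_max => /andP[_]; lra.
Qed.

End MinMax.

Lemma positive_lower_bound (r : seq R) :
  exists2 e : R, 0 < e & forall x, x \in r -> 0 < x -> e <= x.
Proof.
elim: r => [|x r [e e0 h]]; first by exists 1.
have [x0|x0] := ltP 0 x; last first.
  by exists e => // y; rewrite inE => /predU1P[->|/h//]; rewrite ltNge x0.
exists (Num.min e x) => [|y]; first by rewrite lt_min e0.
by rewrite inE ge_min => /predU1P[->|/h e1 /e1->//]; rewrite lexx orbT.
Qed.

Lemma separation (S : seq X) :
  exists2 e : R, 0 < e & forall x y, x \in S -> y \in S -> x != y -> e <= `|x - y|.
Proof.
have [e e0 h] := positive_lower_bound [seq `|x - y| | x <- S, y <- S].
exists e => // x y xS yS xy; apply: h; last by rewrite normr_gt0 subr_eq0.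
by apply: allpairs_f.
Qed.

Lemma finite_kernel (S : seq X) : exists k : X -> X -> R,
  [/\ psd k, forall x, k x x = 1,
   forall x y, x \in S -> y \in S -> 20 * (s%:R * D) <= `|x - y| -> k x y <= 1 / 2 &
   forall x y, x \in S -> y \in S -> kdist k x y <= 256 * `|x - y|].
Proof.
(* The extra point makes the index type nonempty. *)
pose S' := 0 :: S.
pose pt (i : 'I_(size S').-1.+1) := nth 0 S' i.
have [e e0 sep] := separation S.
have e2 : 0 < e / 2 by lra.
(* Distinct points of [S] are at least [e] apart, so the additive errors fit into doubling the
   constant 128. *)
have [k [[pk k1 kf] kd]] := near_optimal_kernel ord0 pt e2.
have ptE x : x \in S -> exists i, pt i = x.
  move=> xS; have xi : (index x S' < (size S').-1.+1)%N.
    by rewrite index_mem inE xS orbT.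
  by exists (Ordinal xi); rewrite /pt nth_index// inE xS orbT.
exists k; split=> // x y xS yS.
  by have [[i <-] [j <-]] := (ptE x xS, ptE y yS); exact: kf.
have [<-|xy] := eqVneq x y.
  by rewrite subrr normr0 mulr0 /kdist; lra.
have := sep x y xS yS xy; have [[i <-] [j <-]] := (ptE x xS, ptE y yS).
by have := kd i j; lra.
Qed.

(** Scale [j] has weight [4^-j] and dilates distances by [2^j], so the upper bounds form a geometric
    series. For the lower bound, a single term suffices: the first scale at which [x] and [y] become
    far. *)
Lemma multiscale_kernel (S : seq X) : exists k : X -> X -> R,
  [/\ psd k, forall x, k x x <= 2,
   forall x y, x \in S -> y \in S ->
     Num.min 1 (`|x - y| / (s%:R * D)) ^+ 2 <= 1600 * kdist k x y &
   forall x y, x \in S -> y \in S -> kdist k x y <= 512 * `|x - y|].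
Proof.
have [e e0 sep] := separation S.
have sD0 : 0 < s%:R * D by rewrite mulr_gt0 ?ltr0n// (lt_trans ltr01).
have Tlt (r : R) : 0 < r -> exists n, 20 * (s%:R * D) <= 2 ^+ n * r.
  move=> r0; pose n := (Num.truncn (20 * (s%:R * D) / r)).+1; exists n.
  rewrite -ler_pdivrMr//.
  have /andP[_ /ltW h] : (Num.truncn (20 * (s%:R * D) / r))%:R <= 20 * (s%:R * D) / r < n%:R.
    by apply: truncn_itv; rewrite divr_ge0 ?(ltW r0)// mulr_ge0// ltW.
  by apply: le_trans h _; rewrite -natrX ler_nat ltnW// ltn_expl.
(* At scale [n] even the closest distinct points of [S] are far. *)
have [n nP] := Tlt e e0.
pose S' := [seq (2 ^+ j : R) *: x | j <- iota 0 n.+1, x <- S].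
have [k0 [pk k1 kf kd]] := finite_kernel S'.
have S'P j x : (j <= n)%N -> x \in S -> (2 ^+ j : R) *: x \in S'.
  by move=> jn xS; apply: allpairs_f => //; rewrite mem_iota add0n.
pose w (j : nat) : R := (4 ^+ j)^-1.
pose K j x y : R := k0 (2 ^+ j *: x) (2 ^+ j *: y).
have w0 j : 0 <= w j by rewrite invr_ge0 exprn_ge0.
have geo : \sum_(j <- iota 0 n.+1) (2 ^+ j)^-1 <= 2 :> R.
  rewrite -[iota _ _]/(index_iota 0 n.+1).
  suff -> : \sum_(0 <= j < n.+1) (2 ^+ j)^-1 = 2 - (2 ^+ n)^-1 :> R.
    by rewrite gerBl invr_ge0 exprn_ge0.
  elim: n {nP S' k0 pk k1 kf kd S'P K} => [|n IH]; first by rewrite big_nat1 expr0; field.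
  have h : (2 : R) ^+ n != 0 by rewrite expf_neq0.
  by rewrite big_nat_recr//= IH exprS; field.
have pK j : psd (K j) by exact: (psd_preim (fun x => 2 ^+ j *: x) pk).
have KdE j x y : kdist (K j) x y = kdist k0 (2 ^+ j *: x) (2 ^+ j *: y) by [].
exists (fun x y => \sum_(j <- iota 0 n.+1) w j * K j x y); split.
- exact: psd_sum.
- move=> x; apply: le_trans geo; apply: ler_sum => j _.
  rewrite /K k1 mulr1 /w lef_pV2 ?posrE ?exprn_gt0//.
  by rewrite lerXn2r ?nnegrE ?ler_nat.
- move=> x y xS yS; rewrite kdist_sum.
  have [<-|xy] := eqVneq x y.
    rewrite subrr normr0 mul0r min_r ?ler01// expr0n.
    apply: mulr_ge0; first exact: ler0n.
    by apply: sumr_ge0 => j _; rewrite mulr_ge0 ?kdist_ge0.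
  have r0 : 0 < `|x - y| by rewrite normr_gt0 subr_eq0.
  have exj : exists j, 20 * (s%:R * D) <= 2 ^+ j * `|x - y| by exact: Tlt.
  case: (ex_minnP exj) => j jP jmin.
  have jn : (j <= n)%N.
    by apply: jmin; apply: le_trans nP _; rewrite ler_wpM2l ?exprn_ge0// sep.
  have lower : w j <= \sum_(i <- iota 0 n.+1) w i * kdist (K i) x y.
    have ji : j \in iota 0 n.+1 by rewrite mem_iota add0n.
    rewrite (bigD1_seq j ji (iota_uniq _ _)).
    apply: (@le_trans _ _ (w j * kdist (K j) x y)); last first.
      by rewrite lerDl sumr_ge0// => i _; rewrite mulr_ge0 ?kdist_ge0.
    rewrite -[leLHS]mulr1 ler_wpM2l// KdE /kdist !k1.
    have : k0 (2 ^+ j *: x) (2 ^+ j *: y) <= 1 / 2.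
      by apply: kf; rewrite ?S'P// -scalerBr normrZ ger0_norm ?exprn_ge0.
    by lra.
  apply: (@le_trans _ _ (1600 * w j)); last by rewrite ler_wpM2l ?ler0n.
  have min0 : 0 <= Num.min 1 (`|x - y| / (s%:R * D)).
    by rewrite le_min ler01 divr_ge0// ltW.
  case: j jP jmin jn lower => [|j] jP jmin jn lower.
    rewrite /w expr0 invr1 mulr1; apply: (@le_trans _ _ (1 ^+ 2)).
      by rewrite lerXn2r ?nnegrE// ge_min lexx.
    by rewrite expr1n; lra.
  (* The preceding scale falls short, so the ratio to [s D] is below [40 / 2^(j+1)]; hence the
     constant [1600 = 40^2]. *)
  have small : 2 ^+ j * `|x - y| < 20 * (s%:R * D).
    by rewrite ltNge; apply/negP => /jmin; rewrite ltnn.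
  have pj : (0 : R) < 2 ^+ j by rewrite exprn_gt0.
  have -> : w j.+1 = (2 * 2 ^+ j)^-1 ^+ 2.
    by rewrite /w exprVn -exprS -exprM mulnC exprM; congr (_ ^+ _)^-1; ring.
  rewrite (_ : 1600 = 40 ^+ 2) -?exprMn; last by ring.
  rewrite lerXn2r ?nnegrE ?mulr_ge0 ?invr_ge0 ?(ltW pj)//.
  rewrite ge_min; apply/orP; right.
  rewrite ler_pdivrMr// mulrAC ler_pdivlMr ?mulr_gt0//.
  by lra.
- move=> x y xS yS; rewrite kdist_sum.
  rewrite (_ : 512 * _ = 2 * (256 * `|x - y|)); last by ring.
  apply: le_trans (ler_wpM2r _ geo); last by rewrite mulr_ge0.
  rewrite mulr_suml big_seq [leRHS]big_seq; apply: ler_sum => j; rewrite mem_iota add0n => jn.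
  have := kd _ _ (S'P j x jn xS) (S'P j y jn yS); rewrite -KdE -scalerBr normrZ.
  rewrite ger0_norm ?exprn_ge0// => h.
  apply: le_trans (ler_wpM2l (w0 j) h) _.
  have pj : (2 : R) ^+ j != 0 by rewrite expf_neq0.
  rewrite /w (_ : (4 : R) = 2 * 2); last by ring.
  by rewrite exprMn le_eqVlt; apply/orP; left; apply/eqP; field.
Qed.

End FiniteKernels.

(** * Compactness *)

(** The image filter clusters in a compact segment, and a cluster point of an ultrafilter is a
    limit. *)
Lemma ultra_bounded_cvg (R : realType) (T : Type) (G : set_system T)
    (f : T -> R) (M : R) : UltraFilter G -> (forall t, `|f t| <= M) ->
  exists l : R, f @ G --> l.
Proof.
move=> UG fM.
have GM : (f @ G) [set x | x \in `[(- M), M]].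
  by apply: (@filterE _ G) => t /=; rewrite in_itv /= -ler_norml.
have [l [_ lc]] := segment_compact _ GM.
exists l => B lB.
have [//|nB] := in_ultra_setVsetC (f @^-1` B) UG.
by have [x []] := lc (~` B) B nB lB.
Qed.

(** The filter of properties holding for all sufficiently large finite sets, ordered by
    inclusion. *)
Definition seq_up (T : eqType) : set_system (seq T) :=
  [set A | exists S0 : seq T, forall S : seq T, {subset S0 <= S} -> A S].

Lemma seq_up_proper (T : eqType) : ProperFilter (@seq_up T).
Proof.
split; first by case=> S0 /(_ S0); exact.
split.
- by exists [::].
- move=> A B [S1 h1] [S2 h2]; exists (S1 ++ S2) => S sub; split.
    by apply: h1 => x xS; apply: sub; rewrite mem_cat xS.
  by apply: h2 => x xS; apply: sub; rewrite mem_cat xS orbT.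
- by move=> A B AB [S1 h1]; exists S1 => S /h1/AB.
Qed.

(** Take the pointwise limit of the finite kernels along an ultrafilter refining [seq_up]. Any given
    pair eventually lies in [S], and the non-strict inequalities pass to the limit. *)
Lemma global_kernel (R : realType) (X : normedModType R) (D : R) (s : nat) :
  (0 < s)%N -> 1 < D -> has_DTEP_protocol X D s ->
  exists k : X -> X -> R, [/\ psd k,
   forall x y, Num.min 1 (`|x - y| / (s%:R * D)) ^+ 2 <= 1600 * kdist k x y &
   forall x y, kdist k x y <= 512 * `|x - y|].
Proof.
move=> s0 D1 prot.
have /boolp.choice[kk kkP] := multiscale_kernel s0 D1 prot.
have [G [UG FG]] := ultraFilterLemma (@seq_up_proper X).
have Gin x y : G [set S : seq X | x \in S /\ y \in S].
  apply: FG; exists [:: x; y] => S sub.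
  by split; apply: sub; rewrite !inE eqxx ?orbT.
have lim x y : exists l : R, (fun S => kk S x y) @ G --> l.
  apply: (ultra_bounded_cvg (M := 2)) => S; have [pk k2 _ _] := kkP S.
  exact: psd_abs_le.
have /boolp.choice[k kP] : forall u : X * X, exists l : R, (fun S => kk S u.1 u.2) @ G --> l.
  by move=> [x y]; exact: lim.
have kl x y : (fun S => kk S x y) @ G --> k (x, y) by exact: (kP (x, y)).
have distl x y : (fun S => kdist (kk S) x y) @ G --> kdist (fun x y => k (x, y)) x y.
  apply: cvgB; first by apply: cvgD; exact: kl.
  by apply: cvgM; [exact: cvg_cst|exact: kl].
exists (fun x y => k (x, y)); split.
- split=> [x y|r].
    have := kl y x; rewrite (_ : (fun S => kk S y x) = (fun S => kk S x y)).
      by move=> h; apply: (cvg_unique _ (kl x y) h).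
    by apply/funext => S; have [[]] := kkP S.
  have h : (fun S => \sum_(u <- r) \sum_(v <- r) u.1 * v.1 * kk S u.2 v.2) @ G -->
      \sum_(u <- r) \sum_(v <- r) u.1 * v.1 * k (u.2, v.2).
    apply: cvg_big => [|u _]; first exact: add_continuous.
    apply: cvg_big => [|v _]; first exact: add_continuous.
    by apply: cvgM; [exact: cvg_cst|exact: kl].
  apply: (cvgr_to_ge h); apply: filterE => S.
  by have [[_ +] _ _ _] := kkP S; apply.
- move=> x y.
  have h : (fun S => 1600 * kdist (kk S) x y) @ G -->
      1600 * kdist (fun x y => k (x, y)) x y.
    by apply: cvgM; [exact: cvg_cst|exact: distl].
  apply: (cvgr_to_ge h); apply: filterS (Gin x y) => S [xS yS].
  by have [_ _ + _] := kkP S; apply.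
- move=> x y; apply: (cvgr_to_le (distl x y)); apply: filterS (Gin x y) => S [xS yS].
  by have [_ _ _] := kkP S; apply.
Qed.

(** * A countable dense set of pivots and the embedding *)

Lemma finite_dimensional_dense (R : realType) (X : normedModType R) :
  finite_dimensional X ->
  exists a : nat -> X, forall (x : X) (e : R), 0 < e -> exists j, `|x - a j| < e.
Proof.
move=> [n [[phi philin [psi phiK psiK]]]].
pose L : {linear X -> 'rV[R]_n} :=
  HB.pack phi (GRing.isLinear.Build R X 'rV[R]_n *:%R phi philin).
pose b (i : 'I_n) : X := psi (delta_mx 0 i).
have coord x : x = \sum_i phi x 0 i *: b i.
  apply: (can_inj phiK); rewrite -[phi in RHS]/(L : _ -> _) linear_sum /=.
  rewrite [LHS]row_sum_delta; apply: eq_bigr => i _.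
  by rewrite -[phi in RHS]/(L : _ -> _) linearZ /= psiK.
(* The rational combinations of a basis are dense and are enumerated by [unpickle]. *)
pose pt (q : 'rV[rat]_n) : X := \sum_i ratr (q 0 i) *: b i.
exists (fun j => pt (odflt 0 (unpickle j))) => x e e0.
pose M := \sum_i `|b i| + 1.
have M0 : 0 < M by rewrite ltr_wpDl// sumr_ge0.
have d0 : 0 < e / M by rewrite divr_gt0.
have /boolp.choice[q qP] : forall i, exists q : rat, `|phi x 0 i - ratr q| < e / M.
  move=> i; have : phi x 0 i - e / M < phi x 0 i + e / M by lra.
  by move=> /rat_in_itvoo[q]; rewrite in_itv /= => h; exists q; rewrite ltr_distlC.
exists (pickle (\row_i q i)); rewrite pickleK /=.
rewrite [x in x - _]coord /pt -sumrB; under eq_bigr do rewrite mxE -scalerBl.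
apply: le_lt_trans (ler_norm_sum _ _ _) _.
apply: (@le_lt_trans _ _ (\sum_i e / M * `|b i|)).
  by apply: ler_sum => i _; rewrite normrZ ler_wpM2r// ltW.
rewrite -mulr_sumr mulrAC ltr_pdivrMr// ltr_pM2l// /M; lra.
Qed.

Theorem theorem3p1 (R : realType) :
  exists2 K : R, 1 < K &
    forall (X : normedModType R) (D : R) (s : nat),
      finite_dimensional X -> 1 < D -> has_DTEP_protocol X D s ->
      exists (H : completeNormedModType R) (f : X -> H),
        hilbert H /\
        forall x1 x2 : X,
          Num.min 1 (`|x1 - x2| / (s%:R * D)) <= `|f x1 - f x2|
            <= K * Num.sqrt `|x1 - x2|.
Proof.
(* The squared upper constant produced below is [1600 * 512 = 819200], less than [1000^2]. *)
exists 1000; first by lra.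
move=> X D s fdX D1 prot; exists (ell2 R).
have up0 (r : R) : 0 <= 1000 * Num.sqrt r.
  by apply: mulr_ge0; [exact: ler0n|exact: sqrtr_ge0].
(* For [s = 0] the quotient by [s D] is 0 by convention, and a constant map satisfies both
   bounds. *)
have [->|s0] := posnP s.
  exists (fun=> 0); split=> [|x y]; first exact: hilbert_ell2.
  by rewrite mul0r invr0 mulr0 subrr normr0 ge_min lexx orbT up0.
have [k [pk lower upper]] := global_kernel s0 D1 prot.
have [a aP] := finite_dimensional_dense fdX.
have denseK z (e : R) : 0 < e -> exists j, kdist k z (a j) < e.
  move=> e0; have [j zj] := aP z (e / 512) ltac:(by lra).
  by exists j; apply: le_lt_trans (upper _ _) _; lra.
(* Scaling by 40 absorbs the factor 1600 of the lower bound on [kdist k]. *)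
exists (fun x => 40 *: feature a pk x); split=> [|x y]; first exact: hilbert_ell2.
have -> : `|40 *: feature a pk x - 40 *: feature a pk y| =
    40 * `|feature a pk x - feature a pk y|.
  by rewrite -scalerBr normrZ ger0_norm ?ler0n.
have N0 : 0 <= 40 * `|feature a pk x - feature a pk y|.
  by apply: mulr_ge0; [exact: ler0n|exact: normr_ge0].
have N2 : (40 * `|feature a pk x - feature a pk y|) ^+ 2 = 1600 * kdist k x y.
  by rewrite exprMn (feature_dist _ _ _ denseK); congr (_ * _); ring.
have min0 : 0 <= Num.min 1 (`|x - y| / (s%:R * D)).
  by rewrite le_min ler01 divr_ge0// mulr_ge0// ltW// (lt_trans ltr01).
apply/andP; split.
  by rewrite -(@ler_pXn2r _ 2) ?nnegrE// N2.
rewrite -(@ler_pXn2r _ 2) ?nnegrE ?up0// N2.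
rewrite exprMn sqr_sqrtr ?normr_ge0//.
by have := upper x y; have := normr_ge0 (x - y); lra.
Qed.
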